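(* Consider the interacting innovation model described in the context, and suppose that the matrix $W$ is irreducible. Let $c$ be a color and consider the event that $c$ is drawn (from some urn) at some time-step. Then, almost surely on this event, for each $h=1,\dots,N$, $$\frac1t K_t(h,c)\longrightarrow K_\infty(c),$$ where $K_\infty(c)$ is a random variable taking values in $(0,1]$ that does not depend on $h$. Consequently, for each $h=1,\dots,N$, $$\frac{K_t(h,c)}{\sum_{j=1}^N K_t(j,c)}\longrightarrow\frac1N\quad\text{almost surely on the same event.}$$
   Context: Fix an integer $N\ge1$, parameters $\theta_1,\dots,\theta_N>0$ and non-negative $N\times N$ matrices $\Gamma=(\gamma_{j,h})$, $\Lambda=(\lambda_{j,h})$ and $W=(w_{j,h})=\Gamma+\Lambda$ such that $\mathbf 1^\top W=\mathbf 1^\top$ (i.e. $\sum_j w_{j,h}=1$ for every $h$), $\sum_j\gamma_{j,h}<1$ for every $h$, and $\lambda_{h,h}>0$ for every $h$; here $\mathbf 1$ denotes the all-ones vector. The model is a system of $N$ interacting urns (agents) with infinitely many possible colors (items). At each time-step $t\ge1$ exactly one color $C_{t,h}$ is drawn from each urn $h=1,\dots,N$. A color drawn at time $t$ is called ''new'' if it was never drawn from any urn of the system at a time $<t$, and ''old'' otherwise; by construction the same new color is never drawn simultaneously from two different urns, so every color $c$ that is ever drawn has a unique urn $j^*(c)$ from which it was drawn for the first time. Let $\mathcal F_t$ be the $\sigma$-field generated by all draws up to time $t$. Let $K_t(j,c)$ be the number of $n\le t$ with $C_{n,j}=c$; let $D^*_{t,j}$ be the number of distinct colors whose first drawing in the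 whole system occurred from urn $j$ at a time $\le t$ (so $D^*_{0,j}=0$); let $D^*_t=\sum_{j}D^*_{t,j}$ (the number of distinct colors drawn in the system up to time $t$); and let $D_{t,h}$ be the number of distinct colors drawn from urn $h$ up to time $t$. Dynamics: conditionally on $\mathcal F_t$, the draws $C_{t+1,1},\dots,C_{t+1,N}$ are independent and, for each $h$, $$P(C_{t+1,h}\text{ is new}\mid\mathcal F_t)=Z^*_{t,h}:=\frac{\theta_h+\sum_{j=1}^N\gamma_{j,h}D^*_{t,j}}{\theta_h+t},$$ while for each old color $c$ (drawn at some time $\le t$), $$P(C_{t+1,h}=c\mid\mathcal F_t)=P_t(h,c):=\frac{\sum_{j=1}^N w_{j,h}K_t(j,c)-\gamma_{j^*(c),h}}{\theta_h+t}.$$ A non-negative square matrix is irreducible if the directed graph having it as adjacency matrix is strongly connected. *)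

(* Defs.v *)
From HB Require Import structures.
From mathcomp Require Import all_boot all_order all_algebra.
From mathcomp Require Import all_classical all_reals all_analysis.
Set Implicit Arguments. Unset Strict Implicit. Unset Printing Implicit Defensive.
Import Order.TTheory GRing.Theory Num.Theory.
Local Open Scope ring_scope.

(* Colors are labelled by natural numbers.  A (realised) history is a function
   H : nat -> 'I_N -> nat, where H n j is the color drawn from urn j at time
   n+1 (times are shifted by one: index n corresponds to time-step n+1).
   Quantities "at time t" only look at the indices n < t (time-steps <= t). *)

Section Hist.
Variable N : nat.
Implicit Types (H : nat -> 'I_N -> nat) (t n : nat) (x c : nat).

Definition Kc H t (j : 'I_N) c : nat := \sum_(n < t) (H n j == c).

Definition isnew H n x : bool := [forall m : 'I_n, forall i : 'I_N, H m i != x].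

Definition old H t x : bool := [exists m : 'I_t, exists i : 'I_N, H m i == x].

(* D*_{t,j}: number of distinct colors whose first drawing occurred from urn j
   at a time-step <= t *)
Definition Dstar H t (j : 'I_N) : nat := \sum_(n < t) isnew H n (H n j).

(* c was drawn for the first time in the system from urn j, at a time <= t
   (i.e. j = j*(c) when c is old) *)
Definition firstfrom H t (j : 'I_N) c : bool :=
  [exists n : 'I_t, (H n j == c) && isnew H n c].

Variable R : realType.
Variables (theta : 'I_N -> R) (Gamma W : 'M[R]_N).

Definition Zstar H t (h : 'I_N) : R :=
  (theta h + \sum_(j < N) Gamma j h * (Dstar H t j)%:R) / (theta h + t%:R).

(* P_t(h,c) for an old color c; the term gamma_{j*(c),h} is written as
   \sum_j gamma_{j,h} [j = j*(c)] *)
Definition Pold H t (h : 'I_N) c : R :=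
  (\sum_(j < N) W j h * (Kc H t j c)%:R
   - \sum_(j < N) Gamma j h * (firstfrom H t j c)%:R) / (theta h + t%:R).

(* conditional probability that the draw of urn h at time t+1 has "type" y:
   None = a new color, Some c = the old color c *)
Definition kern H t (h : 'I_N) (y : option nat) : R :=
  match y with None => Zstar H t h | Some c => Pold H t h c end.
End Hist.

Definition irreducible_mx (R : realType) N (A : 'M[R]_N) : Prop :=
  forall i j : 'I_N, connect (fun a b => 0 < A a b) i j.

Section Proc.
Variables (T : Type) (N : nat) (C : nat -> 'I_N -> T -> nat).

Definition histw (w : T) : nat -> 'I_N -> nat := fun n j => C n j w.

(* the event {draws up to time t coincide with H} (generates F_t) *)
Definition hist_ev t (H : nat -> 'I_N -> nat) : set T :=
  [set w | forall n (j : 'I_N), (n < t)%N -> C n j w = H n j].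

Definition typ t (h : 'I_N) (w : T) : option nat :=
  if old (histw w) t (C t h w) then Some (C t h w) else None.
End Proc.

(* Main.v *)
(* Fix the color c and work on the event that c is old at time tau.  Only the
   marginal conditional laws of the indicators of "urn h draws c" are needed.
   Let pi > 0 be the stationary vector W pi = pi, sum pi = 1, and write
   x_t(h) = K_t(h,c)/t.
   - Synchronisation: E[sum_h pi_h x_t(h)^2] decreases, up to O(1/t^2), by
     E[D_t]/(t+1), where D_t = sum_{h,j} pi_h w_{j,h} (x_t(h) - x_t(j))^2 is the
     Dirichlet form.  Hence sum_t D_t/(t+1) < oo a.s.; as D_t varies slowly,
     D_t -> 0, and irreducibility propagates x_t(h) - x_t(j) -> 0 along edges.
   - Convergence: M_t = sum_h pi_h x_t(h) is a martingale up to drift O(1/t^2),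
     with increments O(1/t), so E[(M_n - M_m)^2] <= C (n - m)/m^2.  Along cubes
     the L1 increments are summable, and M moves by O(1/k) from k^3 to (k+1)^3.
   - Positivity: with S_t = t M_t and theta the sum of the theta_h,
     ln ((theta + t)/S_t) + kappa/S_t is a nonnegative supermartingale for kappa
     large; the second term absorbs the second order error of the logarithm.
     By Fatou its liminf is finite a.s., which forces lim M_t > 0. *)

Require Import Defs.
From HB Require Import structures.
From mathcomp Require Import all_boot all_order all_algebra.
From mathcomp Require Import all_classical all_reals all_analysis.
From mathcomp Require Import measurable_realfun.
From mathcomp Require Import ring lra zify.
Import Order.TTheory GRing.Theory Num.Theory.
Import numFieldNormedType.Exports.
Set Implicit Arguments. Unset Strict Implicit. Unset Printing Implicit Defensive.
Local Open Scope ring_scope.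
Local Open Scope classical_set_scope.

(** * Histories and the stationary vector *)

Section HistoryFacts.
Variable N : nat.
Implicit Types (H : nat -> 'I_N -> nat) (t n c : nat) (j h : 'I_N).

Lemma oldP H t c :
  reflect (exists n j, (n < t)%N /\ H n j = c) (old H t c).
Proof.
apply: (iffP existsP) => [[m /existsP[i /eqP <-]]|[n [j [nt <-]]]].
  by exists m, i.
by exists (Ordinal nt); apply/existsP; exists j.
Qed.

Lemma isnewE H n c : isnew H n c = ~~ old H n c.
Proof.
rewrite /isnew /old negb_exists; apply: eq_forallb => m.
by rewrite negb_exists.
Qed.

Lemma old_mono H t t' c : (t <= t')%N -> old H t c -> old H t' c.
Proof.
move=> tt' /oldP[n [j [nt <-]]]; apply/oldP.
by exists n, j; split => //; exact: leq_trans tt'.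
Qed.

(* The sums in [Kc] and [Dstar] are ring sums in the semiring nat. *)
Lemma KcE H t j c : Kc H t j c = (\sum_(n < t) (H n j == c))%N.
Proof. by []. Qed.

Lemma DstarE H t j : Dstar H t j = (\sum_(n < t) isnew H n (H n j))%N.
Proof. by []. Qed.

(** The summand is true for at most one [n]: a draw of [c] while it is new excludes earlier draws
    and makes [c] old at every later index. As a sum, the indicator can be compared with [Kc] term
    by term and summed over colors. *)
Lemma firstfromE H t j c :
  firstfrom H t j c = (\sum_(n < t) ((H n j == c) && isnew H n c))%N :> nat.
Proof.
rewrite /firstfrom; case: existsP => [[n /andP[/eqP Hn new_n]]|nex].
  rewrite (bigD1 n)//= Hn eqxx new_n big1 ?addn0// => m mn.
  case: eqP => //= Hm; rewrite isnewE; case: (ltngtP m n) => [lt_mn|lt_nm|/val_inj eq_mn].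
  - move: new_n; rewrite isnewE => /negP[]; apply/oldP.
    by exists m, j.
  - suff -> : old H m c by [].
    by apply/oldP; exists n, j.
  - by rewrite eq_mn eqxx in mn.
by rewrite big1// => n _; case: (boolP (_ && _)) => // Hn; case: nex; exists n.
Qed.

Lemma firstfrom_le_Kc H t j c : (firstfrom H t j c <= Kc H t j c)%N.
Proof.
by rewrite firstfromE KcE; apply: leq_sum => n _; case: (_ == _) => //; case: isnew.
Qed.

Lemma Kc_le H t j c : (Kc H t j c <= t)%N.
Proof.
rewrite KcE -[leqRHS]card_ord -sum1_card; apply: leq_sum => n _.
exact: leq_b1.
Qed.

Lemma KcS H t j c : Kc H t.+1 j c = (Kc H t j c + (H t j == c))%N.
Proof. by rewrite !KcE big_ord_recr. Qed.

Lemma old_firstfrom H t c : old H t c -> exists j, firstfrom H t j c.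
Proof.
move=> oldc; have ex : exists n, old H n c by exists t.
(* The least time at which [c] is old is a successor, since nothing is old at time 0; the first draw
   of [c] has the preceding index. *)
case: (ex_minnP ex) => -[|m] oldm minm; first by case/oldP: oldm => n [j []].
have mt : (m < t)%N by exact: minm.
have newm : isnew H m c.
  by rewrite isnewE; apply/negP => /minm; rewrite ltnn.
case/oldP: oldm => n [j [nm Hn]]; exists j; apply/existsP.
exists (Ordinal mt); rewrite newm andbT /=.
move: nm; rewrite ltnS leq_eqVlt => /orP[/eqP <-|nm]; first by rewrite Hn.
by have := newm; rewrite isnewE => /negP[]; apply/oldP; exists n, j.
Qed.

Definition old_colors H t : seq nat :=
  undup [seq H p.1 p.2 | p : 'I_t * 'I_N].

Lemma mem_old_colors H t c : (c \in old_colors H t) = old H t c.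
Proof.
rewrite mem_undup; apply/mapP/oldP => [[[n j] _ ->]|[n [j [nt <-]]]].
  by exists n, j.
by exists (Ordinal nt, j) => //; rewrite mem_enum.
Qed.

Lemma sum_old_colors_eq H t n j : (n < t)%N ->
  (\sum_(x <- old_colors H t) (H n j == x) = 1)%N.
Proof.
move=> nt; rewrite (bigD1_seq (H n j)) ?undup_uniq//=; last first.
  by rewrite mem_old_colors; apply/oldP; exists n, j.
by rewrite eqxx big1// => x; rewrite eq_sym => /negPf ->.
Qed.

Lemma sum_Kc H t j : (\sum_(x <- old_colors H t) Kc H t j x = t)%N.
Proof.
under eq_bigr do rewrite KcE.
rewrite exchange_big/= (eq_bigr (fun=> 1%N)); last first.
  by move=> n _; exact: sum_old_colors_eq.
by rewrite sum1_card card_ord.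
Qed.

Lemma sum_firstfrom H t j :
  (\sum_(x <- old_colors H t) firstfrom H t j x = Dstar H t j)%N.
Proof.
under eq_bigr do rewrite firstfromE.
rewrite DstarE exchange_big/=; apply: eq_bigr => n _.
transitivity (\sum_(x <- old_colors H t) (H n j == x) * isnew H n (H n j))%N.
  by apply: eq_bigr => x _; case: eqP => [->|]; rewrite /= ?mul1n.
by rewrite -big_distrl /= sum_old_colors_eq// mul1n.
Qed.

(** These are the values that [typ] can take after the history [H], so that the law of a draw
    becomes a finite sum over a duplicate-free list. *)
Definition old_types H t : seq (option nat) :=
  None :: map Some (old_colors H t).

Lemma old_types_uniq H t : uniq (old_types H t).
Proof.
rewrite /old_types /= map_inj_uniq ?undup_uniq ?andbT; last by move=> ? ? [].
by apply/mapP => -[].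
Qed.

Lemma mem_old_types H t y :
  (y \in old_types H t) = if y is Some c then old H t c else true.
Proof.
case: y => [c|]; rewrite /old_types in_cons//=.
by rewrite mem_map ?mem_old_colors// => ? ? [].
Qed.

Variables (R : realType) (theta : 'I_N -> R) (Gamma W : 'M[R]_N).
Hypothesis theta_gt0 : forall h, 0 < theta h.
Hypothesis W_col_sum : forall h, \sum_(j < N) W j h = 1.

Lemma theta_time_gt0 t h : 0 < theta h + t%:R.
Proof. by rewrite ltr_wpDr. Qed.

(** Conservation of mass: the column sums of [W] give the old colors the total weight [t], and their
    discounts add up to exactly what [Zstar] adds to [theta h]. *)
Lemma sum_kern H t h : \sum_(y <- old_types H t) kern theta Gamma W H t h y = 1.
Proof.
rewrite big_cons big_map /= /Zstar /Pold -mulr_suml -mulrDl.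
have den0 : theta h + t%:R != 0 by rewrite gt_eqF// theta_time_gt0.
rewrite big_split/= sumrN exchange_big/=.
under [X in _ + (X - _)]eq_bigr do rewrite -mulr_sumr -natr_sum sum_Kc.
rewrite -mulr_suml W_col_sum mul1r exchange_big/=.
under [X in _ + (_ - X)]eq_bigr do rewrite -mulr_sumr -natr_sum sum_firstfrom.
by rewrite -addrA [X in (_ + X) / _]addrC subrK divff.
Qed.

End HistoryFacts.

(** * Perron vector of an irreducible column-stochastic matrix *)

Section Stationary.
Variables (R : realType) (N : nat) (W : 'M[R]_N).
Hypothesis N_gt0 : (0 < N)%N.
Hypothesis W_ge0 : forall j h, 0 <= W j h.
Hypothesis W_col_sum : forall h, \sum_(j < N) W j h = 1.
Hypothesis W_irr : irreducible_mx W.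

(** The all-ones row is a left null vector of [W - 1], so the determinant vanishes and there is a
    right null vector too, whose signs are not yet controlled. *)
Lemma exists_fixed_vector : exists2 u : 'I_N -> R, exists j, u j != 0 &
  forall j, \sum_(h < N) W j h * u h = u j.
Proof.
pose A := W - 1%:M.
have h0 : 'I_N := Ordinal N_gt0.
have detA : \det A == 0.
  apply/det0P; exists (const_mx 1).
    by apply/eqP => /matrixP/(_ ord0 h0); rewrite !mxE => /eqP; rewrite oner_eq0.
  apply/matrixP => i h; rewrite !mxE.
  under eq_bigr do rewrite !mxE mul1r.
  rewrite sumrB W_col_sum (bigD1 h)//= eqxx big1 ?addr0 ?subrr// => k kh.
  by rewrite (negPf kh).
move: detA; rewrite -det_tr => /det0P[v v0 vA].
exists (fun h => v ord0 h).
  apply: contrapT => /forallNP nex; move/eqP: v0; apply.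
  apply/rowP => j; rewrite mxE; apply/eqP; apply: contrapT => vj.
  by apply: (nex j); apply/negP.
move=> j; move/matrixP: vA => /(_ ord0 j); rewrite !mxE.
under eq_bigr do rewrite !mxE mulrBr.
rewrite sumrB => /eqP; rewrite subr_eq0 => /eqP vW.
under eq_bigr do rewrite mulrC.
rewrite vW (bigD1 j)//= eqxx mulr1 big1 ?addr0// => k kj.
by rewrite eq_sym (negPf kj) mulr0.
Qed.

(** Perron-Frobenius argument: [v = |u|] satisfies [v <= W v] entrywise, and both sides have the
    same total because the columns sum to 1, so equality holds. A positive entry then forces
    positivity at every index that has a path to it, that is, everywhere. *)
Lemma exists_stationary : exists2 pi : 'I_N -> R,
  (forall h, 0 < pi h) /\ \sum_(h < N) pi h = 1 &
  forall j, \sum_(h < N) W j h * pi h = pi j.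
Proof.
have [u [j0 uj0] uE] := exists_fixed_vector.
pose v h := `|u h|.
have v_le j : v j <= \sum_(h < N) W j h * v h.
  rewrite /v -{1}uE; apply: le_trans (ler_norm_sum _ _ _) _.
  by apply: ler_sum => h _; rewrite normrM (ger0_norm (W_ge0 _ _)).
have vE j : \sum_(h < N) W j h * v h = v j.
  apply/eqP; rewrite eq_sym -subr_eq0 -oppr_eq0 opprB; apply/eqP.
  have : \sum_(j < N) (\sum_(h < N) W j h * v h - v j) = 0.
    rewrite sumrB exchange_big/=; apply/eqP; rewrite subr_eq0; apply/eqP.
    by apply: eq_bigr => h _; rewrite -mulr_suml W_col_sum mul1r.
  move/eqP; rewrite psumr_eq0; last by move=> i _; rewrite subr_ge0.
  by move=> /allP/(_ j (mem_index_enum _))/implyP/(_ isT)/eqP.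
have v_edge a b : 0 < W a b -> 0 < v b -> 0 < v a.
  move=> Wab vb; rewrite -vE (bigD1 b)//= ltr_wpDr ?mulr_gt0//.
  by apply: sumr_ge0 => h _; rewrite mulr_ge0// normr_ge0.
have v_gt0 j : 0 < v j.
  have /connectP[p] := W_irr j j0.
  have : 0 < v j0 by rewrite normr_gt0.
  elim: p j => [|b p IH] a vj0 /=; first by move=> _ <-.
  by move=> /andP[Wab pth] lst; apply: (v_edge _ _ Wab); exact: IH.
pose s := \sum_(h < N) v h.
have s_gt0 : 0 < s.
  by rewrite /s (bigD1 j0)//= ltr_wpDr// sumr_ge0// => h _; exact: ltW.
exists (fun h => v h / s); first split.
- by move=> h; rewrite divr_gt0.
- by rewrite -mulr_suml divff// gt_eqF.
- by move=> j; under eq_bigr do rewrite mulrA; rewrite -mulr_suml vE.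
Qed.

End Stationary.

(** * Real sequences *)

Section RealSequences.
Variable R : realType.
Implicit Types (u v a : nat -> R) (B C : R).

Lemma sum_inv_sqr_le n : \sum_(k < n) (k.+1%:R ^-1) ^+ 2 <= 2 :> R.
Proof.
case: n => [|n]; first by rewrite big_ord0; lra.
(* The extra term [- 1 / (n + 1)] lets the induction close, with slack [1 / (x (x + 1) ^ 2)] for
   [x = n + 1]. *)
suff : \sum_(k < n.+1) (k.+1%:R ^-1) ^+ 2 <= 2 - n.+1%:R^-1 :> R.
  by move/le_trans; apply; rewrite gerBl invr_ge0.
elim: n => [|n IH]; first by rewrite big_ord_recr big_ord0/= invr1; lra.
rewrite big_ord_recr/=; apply: le_trans (lerD IH (lexx _)) _.
have n1 : 0 < n.+1%:R :> R by [].
have -> : n.+2%:R = n.+1%:R + 1 :> R by rewrite -natr1.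
rewrite -subr_ge0; set x := n.+1%:R in n1 *.
have -> : 2 - (x + 1)^-1 - (2 - x^-1 + (x + 1)^-1 ^+ 2) =
          (x * (x + 1) ^+ 2)^-1.
  by field; rewrite !gt_eqF// addr_gt0.
by rewrite invr_ge0 mulr_ge0 ?exprn_ge0 ?addr_ge0// ltW.
Qed.

(** Telescoping of one-step inequalities: [a] will be an expected energy and [u] its expected
    dissipation, whose series is thereby bounded. *)
Lemma sum_drift_le a u C : 0 <= C -> (forall n, 0 <= a n) ->
  (forall n, a n.+1 + u n <= a n + C * n.+1%:R^-1 ^+ 2) ->
  forall n, \sum_(k < n) u k <= a 0%N + C * 2.
Proof.
move=> C0 a0 au n.
have : \sum_(k < n) u k + a n <= a 0%N + C * \sum_(k < n) k.+1%:R^-1 ^+ 2.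
  elim: n => [|n IH]; first by rewrite !big_ord0 mulr0 add0r addr0.
  rewrite !big_ord_recr/= mulrDr; have := au n.
  by move: (C * n.+1%:R^-1 ^+ 2) (C * _) IH => p q IH; lra.
have := a0 n; have := ler_wpM2l C0 (sum_inv_sqr_le n); lra.
Qed.

(** With [s] the partial sums of [a], both [s] and [u + s] are nondecreasing and bounded, so [u] is
    a difference of convergent sequences. *)
Lemma is_cvg_bounded_variation u a B : (forall n, `|u n.+1 - u n| <= a n) ->
  (forall n, \sum_(k < n) a k <= B) -> cvgn u.
Proof.
move=> ua aB; pose s n := \sum_(k < n) a k.
have sS n : s n.+1 = s n + a n by rewrite /s big_ord_recr.
have a_ge0 n : 0 <= a n by apply: le_trans (ua n).
have cs : cvgn s.
  apply: nondecreasing_is_cvgn.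
    by apply/nondecreasing_seqP => n; rewrite sS lerDl.
  by exists B => _ [n _ <-]; exact: aB.
have cv : cvgn (fun n => u n + s n).
  apply: nondecreasing_is_cvgn.
    apply/nondecreasing_seqP => n; rewrite sS.
    by have := ua n; rewrite ler_norml => /andP[]; lra.
  exists (u 0%N + B + B) => _ [n _ <-].
  suff : u n <= u 0%N + s n by have := aB n; rewrite -/(s n); lra.
  elim: n => [|n IH]; first by rewrite /s big_ord0 addr0.
  by rewrite sS; have := ua n; rewrite ler_norml => /andP[]; lra.
have -> : u = (fun n => (u n + s n) - s n) by apply/funext => n; rewrite addrK.
exact: is_cvgB.
Qed.

(* The increments of [v ^+ 2] are summable, so it converges, and a positive
   limit would make the harmonic series converge. *)
Lemma cvg0_slow_variation v C B : (forall n, 0 <= v n) ->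
  (forall n, `|v n.+1 - v n| <= C / n.+1%:R) ->
  (forall n, \sum_(k < n) v k / k.+1%:R <= B) -> v @ \oo --> (0 : R).
Proof.
move=> v0 vC vB.
have C0 : 0 <= C by have := vC 0%N; rewrite divr1; exact: le_trans.
have cv2 : cvgn (fun n => v n ^+ 2).
  (* Since [v n.+1 + v n] is at most [2 * v n + C / n.+1], the increment of the square splits into a
     term summable by hypothesis and an inverse square. *)
  apply: (@is_cvg_bounded_variation _
    (fun n => 2 * C * (v n / n.+1%:R) + C ^+ 2 * n.+1%:R^-1 ^+ 2)
    (2 * C * B + C ^+ 2 * 2)).
    move=> n; have := vC n; have := v0 n; have := v0 n.+1.
    move: (v n) (v n.+1) => x y y0 x0 xy.
    have -> : 2 * C * (x / n.+1%:R) + C ^+ 2 * n.+1%:R^-1 ^+ 2 =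
      (C / n.+1%:R) * (2 * x + C / n.+1%:R) by ring.
    move: xy; set q := C / n.+1%:R => xy.
    rewrite subr_sqr normrM ler_pM//.
    rewrite ger0_norm ?addr_ge0//.
    by move: xy; rewrite ler_norml => /andP[]; lra.
  move=> n; rewrite big_split/= -!mulr_sumr; apply: lerD.
    by apply: ler_wpM2l; [rewrite mulr_ge0|exact: vB].
  by apply: ler_wpM2l; [exact: exprn_ge0|exact: sum_inv_sqr_le].
have /cvg_ex[l v2l] := cv2.
have l0 : 0 <= l.
  rewrite -(cvg_lim _ v2l)//; apply: limr_ge => //.
  by apply: nearW => n; exact: exprn_ge0.
have [l_gt0|l_le0] := ltP 0 l.
  have [n0 _ Hn0] : \forall n \near \oo, l / 2 < v n ^+ 2.
    by apply: (cvgr_gt l) => //; lra.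
  (* If [v n < 1] then [v n >= v n ^ 2 > l / 2]; otherwise [v n >= 1]. Either way [v n >= e]. *)
  pose e := Num.min 1 (l / 2).
  have e0 : 0 < e by rewrite lt_min ltr01/=; lra.
  have ev n : (n0 <= n)%N -> e <= v n.
    move=> /Hn0 /= vn; rewrite /e ge_min; have [//|v1] := leP 1 (v n).
    apply/orP; right; apply: le_trans (ltW vn) _.
    by rewrite expr2 ger_pMl ?ltW// ltNge; apply/negP => ?; move: vn; 
       rewrite (_ : v n = 0) ?expr0n/=; [lra|apply/eqP; rewrite eq_le v0 andbT].
  exfalso; apply: (@dvg_harmonic R); apply: nondecreasing_is_cvgn.
    by apply: nondecreasing_series => n _ _; rewrite /harmonic/= invr_ge0.
  exists (n0%:R + B / e) => _ [n _ <-]; rewrite seriesEord /=.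
  (* The first [n0] harmonic terms cost at most 1 each, and the later ones are dominated by the
     bounded series. *)
  have ind k : harmonic k <= (k < n0)%N%:R + e^-1 * (v k / k.+1%:R) :> R.
    rewrite /harmonic /= mulrA; case: ltnP => [_|/ev evk].
      apply: ler_wpDr; last by rewrite invf_le1 ?ler1n.
      by rewrite mulr_ge0 ?invr_ge0// mulr_ge0// invr_ge0 ltW.
    by rewrite add0r ler_peMl ?invr_ge0// mulrC ler_pdivlMr ?mul1r.
  apply: (@le_trans _ _ (\sum_(k < n) ((k < n0)%N%:R + e^-1 * (v k / k.+1%:R)))).
    by apply: ler_sum => k _; exact: ind.
  rewrite big_split/= -mulr_sumr -natr_sum; apply: lerD.
    rewrite ler_nat; elim: n => [|n IH]; first by rewrite big_ord0.
    have : (\sum_(i < n) (i < n0) <= n)%N.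
      rewrite -[leqRHS]card_ord -sum1_card; apply: leq_sum => i _.
      exact: leq_b1.
    rewrite big_ord_recr/=; case: ltnP => nn0; last by rewrite addn0.
    by move=> Hn; rewrite addn1; exact: leq_ltn_trans Hn nn0.
  by rewrite mulrC; apply: ler_wpM2r; [rewrite invr_ge0 ltW|exact: vB].
have l_eq0 : l = 0 by apply/eqP; rewrite eq_le l_le0.
apply/cvgrPdist_lt => e e0.
have : \forall n \near \oo, v n ^+ 2 < e ^+ 2.
  by apply: (cvgr_lt l) => //; rewrite l_eq0 exprn_gt0.
apply: filterS => n; rewrite sub0r normrN ger0_norm//.
by rewrite ltr_pXn2r// nnegrE// ltW.
Qed.

Lemma increments_bound u n0 :
  (forall n, (n0 <= n)%N -> `|u n.+1 - u n| <= n.+1%:R^-1) ->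
  forall m j, (n0 <= m)%N -> `|u (m + j)%N - u m| <= j%:R / m.+1%:R.
Proof.
move=> uS m j n0m; elim: j => [|j IH]; first by rewrite addn0 subrr normr0 mul0r.
rewrite addnS (_ : _ - _ =
  (u (m + j)%N - u m) + (u (m + j).+1 - u (m + j)%N)); last by ring.
apply: le_trans (ler_normD _ _) _.
rewrite -natr1 mulrDl mul1r; apply: lerD => //.
apply: le_trans (uS _ (leq_trans n0m (leq_addr _ _))) _.
by rewrite lef_pV2 ?posrE// ler_nat ltnS leq_addr.
Qed.

Lemma exists_cube_root t : exists k, (k ^ 3 <= t < k.+1 ^ 3)%N.
Proof.
elim: t => [|t [k /andP[kt tk]]]; first by exists 0%N.
have [tk'|tk'] := ltnP t.+1 (k.+1 ^ 3)%N.
  by exists k; rewrite tk' andbT; exact: leq_trans kt _.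
by exists k.+1; rewrite tk'/= (leq_ltn_trans tk)// ltn_exp2r.
Qed.

(* Between [k ^ 3] and [k.+1 ^ 3] the sequence moves by at most [6 / k]. *)
Lemma cvg_cube_interpolation u (l : R) n0 :
  (forall n, (n0 <= n)%N -> `|u n.+1 - u n| <= n.+1%:R^-1) ->
  (fun k => u (k ^ 3)%N) @ \oo --> l -> u @ \oo --> l.
Proof.
move=> uS ul; apply/cvgrPdist_lt => e e0.
have e2 : 0 < e / 2 by lra.
have [K _ HK] := (cvgrPdist_lt _ _).1 ul _ e2.
(* For [k > 12 / e] the gap [6 / k] is at most [e / 2]. *)
pose K2 := (Num.trunc (12 / e)).+1.
pose K3 := maxn n0 (maxn K K2).
exists (K3 ^ 3)%N => // t /= Kt.
have [k /andP[kt tk]] := exists_cube_root t.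
have K3k : (K3 <= k)%N.
  rewrite leqNgt; apply/negP => kK.
  have kK3 : (k.+1 ^ 3 <= K3 ^ 3)%N by rewrite leq_exp2r.
  by have := leq_trans tk (leq_trans kK3 Kt); rewrite ltnn.
have n0k : (n0 <= k)%N by exact: leq_trans (leq_maxl _ _) K3k.
have Kk : (maxn K K2 <= k)%N by exact: leq_trans (leq_maxr _ _) K3k.
have {}HK : `|l - u (k ^ 3)%N| < e / 2.
  by apply: HK => /=; exact: leq_trans (leq_maxl _ _) Kk.
have K2k : 12 / e < k%:R.
  apply: lt_le_trans (truncnS_gt _) _.
  by rewrite ler_nat; exact: leq_trans (leq_maxr _ _) Kk.
have k0 : 0 < k%:R :> R by apply: lt_trans K2k; rewrite divr_gt0.
have n0k3 : (n0 <= k ^ 3)%N.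
  apply: leq_trans n0k _; rewrite !expnS expn0 muln1; nia.
have := increments_bound uS (t - k ^ 3)%N n0k3; rewrite subnKC// => utk.
have {utk} : `|u t - u (k ^ 3)%N| <= e / 2.
  apply: le_trans utk _; apply: (@le_trans _ _ (6 / k%:R)).
    (* As [t < (k + 1) ^ 3], the number of steps is at most [3 k ^ 2 + 3 k <= 6 k ^ 2], each of size
       below [1 / k ^ 3]. *)
    rewrite ler_pdivrMr// mulrAC ler_pdivlMr// -natrM -!natrM ler_nat.
    move: tk kt; rewrite !expnS expn0 !muln1; nia.
  rewrite ler_pdivrMr//; move: K2k; rewrite ltr_pdivrMr//; nra.
move=> utk; have -> : l - u t = (l - u (k ^ 3)%N) - (u t - u (k ^ 3)%N) by ring.
by apply: le_lt_trans (ler_normB _ _) _; lra.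
Qed.

End RealSequences.

(** * Almost sure bounds from expectations *)

Section BoundedExpectation.
Variables (d : measure_display) (T : measurableType d) (R : realType).
Variable P : probability T R.
Implicit Types f g : T -> R.

(** Every integrand used later is of this kind; under a probability this gives integrability at
    once, and the class is stable under sums and products. *)
Definition bounded_mfun f :=
  measurable_fun setT f /\ exists B, forall w, `|f w| <= B.

Lemma bounded_mfun_integrable f : bounded_mfun f -> P.-integrable setT (EFin \o f).
Proof.
move=> [mf [B fB]]; apply: measurable_bounded_integrable => //.
  exact: le_lt_trans (probability_le1 P measurableT) (ltry 1).
exists B; split; first exact: num_real.
by move=> x Bx w _; apply: le_trans (fB w) (ltW Bx).
Qed.

Lemma bounded_mfunD f g : bounded_mfun f -> bounded_mfun g ->
  bounded_mfun (fun w => f w + g w).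
Proof.
move=> [mf [B fB]] [mg [B' gB]]; split; first exact: measurable_funD.
by exists (B + B') => w; apply: le_trans (ler_normD _ _) _; exact: lerD.
Qed.

Lemma bounded_mfunM f g : bounded_mfun f -> bounded_mfun g ->
  bounded_mfun (fun w => f w * g w).
Proof.
move=> [mf [B fB]] [mg [B' gB]]; split; first exact: measurable_funM.
by exists (B * B') => w; rewrite normrM; exact: ler_pM.
Qed.

Lemma bounded_mfun_cst (r : R) : bounded_mfun (fun=> r).
Proof. by split; [exact: measurable_cst|exists `|r|]. Qed.

Lemma bounded_mfun_sum (I : finType) (f : I -> T -> R) :
  (forall i, bounded_mfun (f i)) -> bounded_mfun (fun w => \sum_i f i w).
Proof.
move=> bf; have -> : (fun w => \sum_i f i w) = \sum_i f i.
  by apply/funext => w; rewrite fct_sumE.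
apply: (big_ind bounded_mfun) => //; first exact: bounded_mfun_cst.
by move=> ? ?; exact: bounded_mfunD.
Qed.

Lemma expectD f g : bounded_mfun f -> bounded_mfun g ->
  (\int[P]_w (f w + g w))%R = (\int[P]_w f w)%R + (\int[P]_w g w)%R.
Proof.
by move=> bf bg; rewrite RintegralD//; exact: bounded_mfun_integrable.
Qed.

Lemma expectZ (r : R) f : bounded_mfun f ->
  (\int[P]_w (r * f w))%R = r * (\int[P]_w f w)%R.
Proof. by move=> bf; rewrite RintegralZl//; exact: bounded_mfun_integrable. Qed.

Lemma expect_le f g : bounded_mfun f -> bounded_mfun g ->
  (forall w, f w <= g w) -> (\int[P]_w f w <= \int[P]_w g w)%R.
Proof.
by move=> bf bg fg; apply: le_Rintegral => //; exact: bounded_mfun_integrable.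
Qed.

Lemma expect_cst (r : R) : (\int[P]_w r)%R = r.
Proof.
rewrite Rintegral_cst// -[RHS]mulr1; congr (_ * _).
by rewrite [X in fine X](_ : _ = 1%E)//; exact: probability_setT.
Qed.

Lemma expect_EFin f : bounded_mfun f ->
  (\int[P]_w (f w)%:E = (\int[P]_w f w)%R%:E)%E.
Proof.
move=> bf; rewrite /Rintegral fineK//; apply: integrable_fin_num => //.
exact: bounded_mfun_integrable.
Qed.

Lemma expect_sum (I : finType) (f : I -> T -> R) :
  (forall i, bounded_mfun (f i)) ->
  (\int[P]_w (\sum_i f i w))%R = \sum_i (\int[P]_w f i w)%R.
Proof.
move=> bf; suff H (s : seq I) : bounded_mfun (fun w => \sum_(i <- s) f i w) /\
    (\int[P]_w (\sum_(i <- s) f i w))%R = \sum_(i <- s) (\int[P]_w f i w)%R.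
  by case: (H (index_enum I)).
elim: s => [|i s [bs IH]].
  have -> : (fun w => \sum_(i <- [::]) f i w) = (fun=> 0).
    by apply/funext => w; rewrite big_nil.
  by split; [exact: bounded_mfun_cst|rewrite expect_cst big_nil].
have -> : (fun w => \sum_(i <- i :: s) f i w) =
    (fun w => f i w + \sum_(i <- s) f i w).
  by apply/funext => w; rewrite big_cons.
by split; [exact: bounded_mfunD|rewrite expectD// IH big_cons].
Qed.

(** By monotone convergence the extended-valued sum of the series has integral at most [B], hence is
    finite almost everywhere and bounds its partial sums. *)
Lemma ae_bounded_series (f : nat -> T -> R) (B : R) :
  (forall n, bounded_mfun (f n)) -> (forall n w, 0 <= f n w) ->
  (forall n, \sum_(k < n) (\int[P]_w f k w)%R <= B) ->
  {ae P, forall w, exists b, forall n, \sum_(k < n) f k w <= b}.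
Proof.
move=> bf f0 fB.
pose g w := (\sum_(n <oo) (f n w)%:E)%E.
have mg : measurable_fun setT g.
  apply: ge0_emeasurable_sum => // n; first by move=> w _ _; rewrite lee_fin.
  by move=> _; apply/measurable_EFinP; case: (bf n).
have intg : P.-integrable setT g.
  apply/integrableP; split => //.
  under eq_integral do (rewrite gee0_abs; last by
    apply: nneseries_ge0 => ? _ _; rewrite lee_fin).
  rewrite integral_nneseries//; last 2 first.
  - by move=> n; apply/measurable_EFinP; case: (bf n).
  - by move=> n w _; rewrite lee_fin.
  apply: (@le_lt_trans _ _ B%:E); last by rewrite ltry.
  apply: lime_le.
    by apply: is_cvg_nneseries => n _ _; apply: integral_ge0 => w _; rewrite lee_fin.
  apply: nearW => n; rewrite big_mkord.
  under eq_bigr do rewrite expect_EFin//.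
  by rewrite sumEFin lee_fin.
have := integrable_ae measurableT intg.
apply: filterS => w /(_ I) gw; exists (fine (g w)) => n.
rewrite -lee_fin fineK// -sumEFin -(big_mkord xpredT (fun k => (f k w)%:E)).
by apply: nneseries_lim_ge => ? _; rewrite lee_fin.
Qed.

Lemma limn_einfE (u : nat -> \bar R) : limn_einf u = ereal_sup (range (einfs u)).
Proof. by rewrite limn_einf_lim; apply/cvg_lim => //; exact: cvg_einfs_sup. Qed.

(** By Fatou the lower limit has finite integral, so it is finite almost everywhere. This bounds [f]
    along infinitely many indices, and for nonnegative supermartingales it stands in for the
    convergence theorem. *)
Lemma ae_frequently_bounded (f : nat -> T -> R) (B : R) :
  (forall n, bounded_mfun (f n)) -> (forall n w, 0 <= f n w) ->
  (forall n, (\int[P]_w f n w)%R <= B) ->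
  {ae P, forall w, exists b, forall n, exists2 m, (n <= m)%N & f m w <= b}.
Proof.
move=> bf f0 fB.
pose g w := limn_einf (fun n => (f n w)%:E).
have mf n : measurable_fun setT (fun w => (f n w)%:E).
  by apply/measurable_EFinP; case: (bf n).
have mg : measurable_fun setT g by
  apply: measurableT_comp => //; apply: measurable_fun_limn_esup => n;
  exact: measurableT_comp.
have g0 w : (0 <= g w)%E.
  rewrite /g limn_einfE.
  apply: le_trans (ereal_sup_ubound (ex_intro2 _ _ 0%N I erefl)).
  by apply: le_ereal_inf_tmp => _ [n _ <-]; rewrite lee_fin.
have intg : P.-integrable setT g.
  apply/integrableP; split => //.
  under eq_integral do rewrite gee0_abs//.
  apply: le_lt_trans (@fatou _ T R P setT measurableT (fun n w => (f n w)%:E) _ _) _ => //.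
    by move=> n w _; rewrite lee_fin.
  apply: (@le_lt_trans _ _ B%:E); last by rewrite ltry.
  rewrite limn_einfE.
  apply: ge_ereal_sup => _ [n _ <-]; apply: le_trans (ereal_inf_lbound _) _.
    by exists n => //=.
  by rewrite expect_EFin// lee_fin.
have := integrable_ae measurableT intg.
apply: filterS => w /(_ I) gw; exists (fine (g w) + 1) => n.
(* The infimum over the tail from [n] is at most the lower limit, so some term of that tail lies
   below the lower limit plus 1. *)
have /ereal_inf_lt[_ [m /= nm <-]] :
    (einfs (fun n => (f n w)%:E) n < (fine (g w) + 1)%:E)%E.
  apply: (@le_lt_trans _ _ (g w)).
    rewrite /g limn_einfE.
    by apply: ereal_sup_ubound; exists n.
  by rewrite EFinD fineK// lteDl// lte_fin.
by rewrite lte_fin => /ltW fm; exists m.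
Qed.
End BoundedExpectation.

(** * Conditional law of a draw *)

Section OneStep.
Variables (R : realType) (d : measure_display) (T : measurableType d).
Variables (P : probability T R) (N : nat) (theta : 'I_N -> R).
Variables (Gamma W : 'M[R]_N) (C : nat -> 'I_N -> T -> nat).
Hypothesis theta_gt0 : forall h, 0 < theta h.
Hypothesis W_col_sum : forall h, \sum_(j < N) W j h = 1.
Hypothesis C_meas : forall t h c, measurable [set w | C t h w = c].
Hypothesis dynamics : forall t (H : nat -> 'I_N -> nat) (y : 'I_N -> option nat),
  (forall h c, y h = Some c -> old H t c) ->
  P (hist_ev C t H `&` [set w | forall h, typ C t h w = y h]) =
  (P (hist_ev C t H) * (\prod_(h < N) kern theta Gamma W H t h (y h))%:E)%E.

Definition same_past t (w w' : T) :=
  forall n (j : 'I_N), (n < t)%N -> C n j w = C n j w'.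

(** This plays the part of F_t-measurability: colors are integers, so there are only countably many
    pasts up to time [t], and a real function of the past is measurable. *)
Definition adapted (U : Type) t (f : T -> U) :=
  forall w w', same_past t w w' -> f w = f w'.

Lemma adapted_mono (U : Type) t t' (f : T -> U) :
  (t <= t')%N -> adapted t f -> adapted t' f.
Proof.
by move=> tt' af w w' ww'; apply: af => n j nt; apply: ww'; exact: leq_trans tt'.
Qed.

Lemma measurable_hist_ev t H : measurable (hist_ev C t H).
Proof.
have -> : hist_ev C t H =
    \bigcap_n \bigcap_(j in [set: 'I_N]) (if (n < t)%N then [set w | C n j w = H n j] else setT).
  apply/seteqP; split => [w Hw n _ j _|w Hw n j nt]; first by case: ifPn => // nt; exact: Hw.
  by have := Hw n I j I; rewrite nt.
apply: bigcapT_measurable => n; apply: fin_bigcap_measurable; first exact: finite_finset.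
by move=> j _; case: ifP => // _; exact: C_meas.
Qed.

Definition hist_code t (w : T) : {ffun 'I_t * 'I_N -> nat} :=
  [ffun p : 'I_t * 'I_N => C p.1 p.2 w].

Lemma hist_code_eq t w w' : hist_code t w = hist_code t w' <-> same_past t w w'.
Proof.
split=> [/ffunP e n j nt|ww']; first by have := e (Ordinal nt, j); rewrite !ffunE.
by apply/ffunP => -[i j]; rewrite !ffunE; exact: ww'.
Qed.

(** Finite histories form a countable type, so [pickle] numbers the atoms of F_t by integers;
    integers that code no realised history give empty cells. *)
Definition hist_cell t (i : nat) : set T :=
  [set w | pickle (hist_code t w) = i].

Lemma hist_cellE t w :
  hist_cell t (pickle (hist_code t w)) = hist_ev C t (histw C w).
Proof.
apply/seteqP; split => [w' /(pcan_inj pickleK)/hist_code_eq ww' //|w' ww'].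
by congr pickle; apply/hist_code_eq.
Qed.

Lemma measurable_hist_cell t i : measurable (hist_cell t i).
Proof.
have [[w wi]|nex] := pselect (exists w, hist_cell t i w).
  by rewrite -wi hist_cellE; exact: measurable_hist_ev.
suff -> : hist_cell t i = set0 by [].
by rewrite -subset0 => w Hw; apply: nex; exists w.
Qed.

Lemma trivIset_hist_cell t : trivIset setT (hist_cell t).
Proof. by move=> i j _ _ [w [<- <-]]. Qed.

Lemma bigcup_hist_cell t : \bigcup_i hist_cell t i = setT.
Proof. by apply/seteqP; split => // w _; exists (pickle (hist_code t w)). Qed.

Lemma adapted_measurable t (A : set T) : adapted t A -> measurable A.
Proof.
move=> aA.
have -> : A = \bigcup_(i in [set pickle (hist_code t w) | w in A]) hist_cell t i.
  apply/seteqP; split => [w Aw|w [_ [w' Aw' <-]]].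
    by exists (pickle (hist_code t w)) => //; exists w.
  by rewrite hist_cellE => ww'; rewrite (aA w w').
by apply: bigcup_measurable => i _; exact: measurable_hist_cell.
Qed.

Lemma adapted_measurable_fun t (f : T -> R) : adapted t f -> measurable_fun setT f.
Proof.
move=> af _ Y _; rewrite setTI; apply: (@adapted_measurable t).
by move=> w w' ww'; rewrite /preimage /= (af w w').
Qed.

Lemma adapted_bounded_mfun t (f : T -> R) B : adapted t f ->
  (forall w, `|f w| <= B) -> bounded_mfun f.
Proof. by move=> af fB; split; [exact: adapted_measurable_fun af|exists B]. Qed.

Lemma old_same_past t w w' : same_past t w w' ->
  old (histw C w) t = old (histw C w') t.
Proof.
move=> ww'; apply/funext => c; apply/oldP/oldP => -[n [j [nt <-]]]; exists n, j.
  by rewrite /histw ww'.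
by rewrite /histw ww'.
Qed.

(** The event is split according to the types drawn from all urns, each joint type having a product
    probability. By distributivity the sum of products is a product of sums, in which every urn
    other than [h] contributes 1 by [sum_kern]. *)
Lemma marginal_step t H (h : 'I_N) c : old H t c ->
  (exists w, hist_ev C t H w) ->
  P (hist_ev C t H `&` [set w | C t h w = c]) =
  (P (hist_ev C t H) * (Pold theta Gamma W H t h c)%:E)%E.
Proof.
move=> oldc [w0 Hw0].
have oldH w : hist_ev C t H w -> old (histw C w) t = old H t.
  move=> Hw; apply/funext => x; apply/oldP/oldP => -[n [j [nt <-]]]; exists n, j.
    by rewrite /histw Hw.
  by rewrite /histw Hw.
pose Y := seq_sub (old_types H t).
pose F (y : {ffun 'I_N -> Y}) := hist_ev C t H `&`
  ([set w | forall k, typ C t k w = val (y k)] `&` [set w | C t h w = c]).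
have -> : hist_ev C t H `&` [set w | C t h w = c] = \bigcup_(y in setT) F y.
  apply/seteqP; split => [w [Hw Cw]|w [y _ [Hw [_ Cw]]]//].
  have typ_in k : typ C t k w \in old_types H t.
    by rewrite mem_old_types /typ oldH//; case: ifP.
  exists [ffun k => SeqSub (typ_in k)] => //; split => //; split => // k.
  by rewrite ffunE.
have mF y : measurable (F y).
  apply: (@adapted_measurable t.+1) => w w' ww'.
  have ww'' : same_past t w w' by move=> n j nt; apply: ww'; rewrite ltnW.
  apply/propext; rewrite /F /hist_ev /typ /= (old_same_past ww'').
  have eqt k : C t k w = C t k w' by exact: ww'.
  split=> -[Hw [typw Cw]]; (split; [|split]).
  - by move=> n j nt; rewrite -ww'' ?Hw.
  - by move=> k; rewrite -eqt.
  - by rewrite -eqt.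
  - by move=> n j nt; rewrite ww'' ?Hw.
  - by move=> k; rewrite eqt.
  - by rewrite eqt.
rewrite measure_fin_bigcup//; last 2 first.
- exact: finite_finset.
- move=> y y' _ _ [w [[_ [Hy _]] [_ [Hy' _]]]].
  by apply/ffunP => k; apply: val_inj; rewrite -Hy -Hy'.
(* The constraint that urn [h] draws [c] is put into its own factor, so the sum runs over all joint
   types and still factorizes. *)
pose G (k : 'I_N) (y : option nat) : R :=
  if (k == h) && (y != Some c) then 0 else kern theta Gamma W H t k y.
have PF y : P (F y) = (P (hist_ev C t H) * (\prod_(k < N) G k (val (y k)))%:E)%E.
  have [yh|yh] := eqVneq (val (y h)) (Some c); last first.
    rewrite (bigD1 h)//= {1}/G eqxx yh mul0r mule0.
    rewrite (_ : F y = set0) ?measure0//; rewrite -subset0 => w [Hw [typw Cw]].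
    by move: yh; rewrite -typw /typ oldH// Cw oldc eqxx.
  rewrite (_ : F y = hist_ev C t H `&` [set w | forall k, typ C t k w = val (y k)]).
    rewrite dynamics.
      congr (_ * (_)%:E)%E; apply: eq_bigr => k _; rewrite /G.
      by case: eqP => //= ->; rewrite yh eqxx.
    by move=> k x ykx; have := valP (y k); rewrite mem_old_types ykx.
  apply/seteqP; split => [w [Hw [typw _]] //|w [Hw typw]]; split => //; split => //.
  have := typw h; rewrite yh /typ; case: ifP => // _ [] //.
have sumG k : \sum_(y : Y) G k (val y) =
    if k == h then Pold theta Gamma W H t h c else 1.
  transitivity (\sum_(y <- old_types H t) G k y).
    rewrite -(big_map val xpredT (G k)); apply: perm_big; apply: uniq_perm.
    - by rewrite map_inj_uniq ?index_enum_uniq//; exact: val_inj.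
    - exact: old_types_uniq.
    - move=> y; apply/mapP/idP => [[z _ ->]|yt]; first exact: valP.
      by exists (SeqSub yt) => //; rewrite mem_index_enum.
  case: eqP => [->|kh]; last first.
    rewrite -(sum_kern Gamma theta_gt0 W_col_sum H t k); apply: eq_bigr => y _.
    by rewrite /G; case: eqP kh.
  rewrite (bigD1_seq (Some c)) ?mem_old_types ?old_types_uniq//=.
  rewrite big1 ?addr0; first by rewrite /G !eqxx.
  by move=> y yc; rewrite /G eqxx yc.
have sumT : \sum_(y : {ffun 'I_N -> Y}) \prod_(k < N) G k (val (y k)) =
    Pold theta Gamma W H t h c.
  rewrite -(bigA_distr_bigA (fun k (y : Y) => G k (val y))).
  rewrite (bigD1 h)//= sumG eqxx big1 ?mulr1// => k kh.
  by rewrite sumG (negPf kh).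
have PH : P (hist_ev C t H) \is a fin_num.
  by apply: fin_num_measure; exact: measurable_hist_ev.
have -> : [set: {ffun 'I_N -> Y}] = [set` index_enum {ffun 'I_N -> Y}].
  by apply/seteqP; split => y //= _; rewrite mem_index_enum.
rewrite -fsbig_seq ?index_enum_uniq//.
rewrite (eq_bigr (fun y : {ffun 'I_N -> Y} =>
  (fine (P (hist_ev C t H)) * \prod_(k < N) G k (val (y k)))%:E)); last first.
  by move=> y _; rewrite EFinM fineK//; exact: PF.
by rewrite sumEFin -mulr_sumr sumT EFinM fineK.
Qed.

Definition drawn t (h : 'I_N) c (w : T) : R := (C t h w == c)%:R.

Lemma adapted_drawn t h c : adapted t.+1 (drawn t h c).
Proof. by move=> w w' ww'; rewrite /drawn ww'. Qed.

Lemma adapted_old t c : adapted t (fun w => old (histw C w) t c).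
Proof. by move=> w w' /old_same_past ->. Qed.

Lemma adapted_Kc t j c : adapted t (fun w => Kc (histw C w) t j c).
Proof.
by move=> w w' ww'; rewrite /Kc; apply: eq_bigr => n _; rewrite /histw ww'.
Qed.

Lemma adapted_firstfrom t j c : adapted t (fun w => firstfrom (histw C w) t j c).
Proof.
move=> w w' ww'; apply: eq_existsb => n; rewrite /histw ww'//; congr (_ && _).
rewrite !isnewE; congr (~~ _); apply: (@adapted_old n) => m i mn.
by apply: ww'; exact: ltn_trans mn _.
Qed.

Lemma adapted_Pold t h c : adapted t (fun w => Pold theta Gamma W (histw C w) t h c).
Proof.
move=> w w' ww'; rewrite /Pold; congr ((_ - _) / _); apply: eq_bigr => j _.
  by rewrite (adapted_Kc _ _ ww').
by rewrite (adapted_firstfrom _ _ ww').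
Qed.

(** Conditioning on F_t, done atom by atom: on a cell [f] and [Pold] are constant and
    [marginal_step] gives the probability of the draw. [Pold] is the law of the draw only for an old
    color, hence the condition that [f] vanishes elsewhere. *)
Lemma expect_step t h c (f : T -> R) B : adapted t f ->
  (forall w, `|f w| <= B) -> (forall w, ~~ old (histw C w) t c -> f w = 0) ->
  bounded_mfun (fun w => f w * Pold theta Gamma W (histw C w) t h c) ->
  (\int[P]_w (f w * drawn t h c w))%R =
  (\int[P]_w (f w * Pold theta Gamma W (histw C w) t h c))%R.
Proof.
move=> af fB f_old bfp.
have bd : bounded_mfun (fun w => f w * drawn t h c w).
  apply: (@adapted_bounded_mfun t.+1 _ B).
    by move=> w w' ww'; rewrite (adapted_drawn h c ww') (adapted_mono _ af ww').
  move=> w; rewrite normrM -[leRHS]mulr1; apply: ler_pM => //.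
  by rewrite /drawn; case: (_ == _); rewrite ?normr1 ?normr0.
congr fine; rewrite -(bigcup_hist_cell t).
have mc := @measurable_hist_cell t; have tc := @trivIset_hist_cell t.
rewrite !integral_bigcup//; last 2 first.
- by rewrite bigcup_hist_cell; exact: bounded_mfun_integrable bfp.
- by rewrite bigcup_hist_cell; exact: bounded_mfun_integrable bd.
apply: eq_eseriesr => i _.
have [[w0 w0i]|nex] := pselect (exists w, hist_cell t i w); last first.
  have -> : hist_cell t i = set0.
    by rewrite -subset0 => w Hw; apply: nex; exists w.
  by rewrite !integral_set0.
have cell_past w : hist_cell t i w -> same_past t w w0.
  by rewrite -w0i => /(pcan_inj pickleK)/hist_code_eq.
have [oldc|notold] := boolP (old (histw C w0) t c); last first.
  rewrite !integral0_eq// => w /cell_past ww0.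
    by rewrite (af w w0)// f_old// mul0r.
  by rewrite (af w w0)// f_old// mul0r.
set p := Pold theta Gamma W (histw C w0) t h c.
pose A := [set w | C t h w = c].
transitivity (\int[P]_(w in hist_cell t i) ((f w0)%:E * (\1_A w)%:E))%E.
  apply: eq_integral => w; rewrite inE => /cell_past ww0.
  rewrite EFinM (af w w0)//; congr (_ * _%:E)%E; rewrite /drawn indicE.
  by congr (_%:R); congr nat_of_bool; apply/eqP/idP => [Cw|/set_mem//]; exact: mem_set.
transitivity (\int[P]_(w in hist_cell t i) (f w0 * p)%:E)%E; last first.
  apply: eq_integral => w; rewrite inE => /cell_past ww0.
  by rewrite (af w w0)// (adapted_Pold h c ww0).
have mA : measurable A by exact: C_meas.
rewrite integralZl//; last first.
  apply: integrableS (bounded_mfun_integrable P _) => //.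
  split; first exact: measurable_indic.
  by exists 1 => w; rewrite indicE; case: (_ \in _); rewrite ?normr1 ?normr0.
rewrite integral_indic// integral_cst// setIC.
have -> : hist_cell t i = hist_ev C t (histw C w0) by rewrite -w0i hist_cellE.
have := @marginal_step t (histw C w0) h c oldc (ex_intro _ w0 (fun _ _ _ => erefl)).
rewrite -/A -/p => PA; transitivity
  ((f w0)%:E * (P (hist_ev C t (histw C w0)) * p%:E))%E; first by congr (_ * _)%E.
by rewrite EFinM muleA muleAC.
Qed.

End OneStep.

(** * Drift estimates *)

Section UrnVectors.
Variables (R : realType) (N : nat) (theta : 'I_N -> R).
Variables (Gamma Lambda W : 'M[R]_N) (pi : 'I_N -> R).
Hypothesis theta_gt0 : forall h, 0 < theta h.
Hypothesis Gamma_ge0 : forall j h, 0 <= Gamma j h.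
Hypothesis Lambda_ge0 : forall j h, 0 <= Lambda j h.
Hypothesis WE : W = Gamma + Lambda.
Hypothesis W_col_sum : forall h, \sum_(j < N) W j h = 1.
Hypothesis Gamma_col_sum : forall h, \sum_(j < N) Gamma j h < 1.
Hypothesis pi_gt0 : forall h, 0 < pi h.
Hypothesis pi_sum : \sum_(h < N) pi h = 1.
Hypothesis pi_stat : forall j, \sum_(h < N) W j h * pi h = pi j.
Implicit Types (k : 'I_N -> nat) (t : nat) (h j : 'I_N).

Definition freq t k h : R := (k h)%:R / t%:R.
Definition mean_freq t k : R := \sum_h pi h * freq t k h.
Definition energy t k : R := \sum_h pi h * freq t k h ^+ 2.
Definition dirichlet t k : R :=
  \sum_h \sum_j pi h * W j h * (freq t k h - freq t k j) ^+ 2.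
Definition mass k : R := \sum_h pi h * (k h)%:R.
Definition theta_sum : R := \sum_h theta h.
(** In the [1 / t] error of the draw probabilities, 1 bounds the discount by [Gamma] and [theta_sum]
    bounds the shift of the denominator. *)
Definition err : R := 1 + theta_sum.
Definition potential kappa t k : R :=
  ln ((theta_sum + t%:R) / mass k) + kappa / mass k.

Lemma W_ge0 j h : 0 <= W j h.
Proof. by rewrite WE mxE addr_ge0. Qed.

Lemma theta_le_sum h : theta h <= theta_sum.
Proof.
by rewrite /theta_sum (bigD1 h)//= lerDl sumr_ge0// => j _; exact: ltW.
Qed.

Lemma theta_sum_ge0 : 0 <= theta_sum.
Proof. by apply: sumr_ge0 => h _; exact: ltW. Qed.

Lemma pi_average_le (a : 'I_N -> R) B : (forall h, a h <= B) ->
  \sum_h pi h * a h <= B.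
Proof.
move=> aB; rewrite -[leRHS]mul1r -pi_sum mulr_suml.
by apply: ler_sum => h _; rewrite ler_wpM2l// ltW.
Qed.

Lemma pi_average_ge (a : 'I_N -> R) B : (forall h, B <= a h) ->
  B <= \sum_h pi h * a h.
Proof.
move=> aB; rewrite -[leLHS]mul1r -pi_sum mulr_suml.
by apply: ler_sum => h _; rewrite ler_wpM2l// ltW.
Qed.

Lemma pi_average_norm (a : 'I_N -> R) B : (forall h, `|a h| <= B) ->
  `|\sum_h pi h * a h| <= B.
Proof.
move=> aB; rewrite ler_norml; apply/andP; split.
  by apply: pi_average_ge => h; move: (aB h); rewrite ler_norml => /andP[].
by apply: pi_average_le => h; move: (aB h); rewrite ler_norml => /andP[].
Qed.

(** * Deterministic estimates at a fixed time *)

Section AtTime.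
Variables (t : nat) (k : 'I_N -> nat) (ff : 'I_N -> bool).
Hypothesis ff_le : forall j, (ff j <= k j)%N.
Hypothesis k_le : forall j, (k j <= t)%N.
Hypothesis ff_ex : exists j, ff j.

(** The numerator of [Pold], with the counts and the first-urn indicators as free vectors, so that
    the drift estimates involve no probability. *)
Definition weight h : R :=
  \sum_j W j h * (k j)%:R - \sum_j Gamma j h * (ff j)%:R.
Definition draw_prob h : R := weight h / (theta h + t%:R).

Local Notation x := (freq t k).

Lemma time_gt0 : (0 < t)%N.
Proof.
have [j ffj] := ff_ex; apply: leq_trans (k_le j).
by apply: leq_trans (ff_le j); rewrite ffj.
Qed.

Lemma time_gt0R : 0 < t%:R :> R. Proof. by rewrite ltr0n time_gt0. Qed.

Lemma freq_ge0 h : 0 <= x h. Proof. by rewrite divr_ge0. Qed.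

Lemma freq_le1 h : x h <= 1.
Proof. by rewrite ler_pdivrMr ?time_gt0R// mul1r ler_nat. Qed.

Lemma weight_term_ge0 j h : 0 <= W j h * (k j)%:R - Gamma j h * (ff j)%:R.
Proof.
rewrite WE mxE mulrDl addrAC -mulrBr addr_ge0 ?mulr_ge0//.
by rewrite subr_ge0; have := ff_le j; rewrite -(ler_nat R).
Qed.

Lemma weightE h :
  weight h = \sum_j (W j h * (k j)%:R - Gamma j h * (ff j)%:R).
Proof. by rewrite sumrB. Qed.

Lemma weight_ge0 h : 0 <= weight h.
Proof. by rewrite weightE; apply: sumr_ge0 => j _; exact: weight_term_ge0. Qed.

Lemma Wk_le h : \sum_j W j h * (k j)%:R <= t%:R.
Proof.
rewrite -[leRHS]mul1r -[X in _ <= X * _](W_col_sum h) mulr_suml.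
by apply: ler_sum => j _; rewrite ler_wpM2l ?W_ge0// ler_nat.
Qed.

Lemma discount_le1 h : \sum_j Gamma j h * (ff j)%:R <= 1.
Proof.
apply: le_trans (ltW (Gamma_col_sum h)); apply: ler_sum => j _.
by rewrite ler_piMr//; case: (ff j).
Qed.

Lemma discount_ge0 h : 0 <= \sum_j Gamma j h * (ff j)%:R.
Proof. by apply: sumr_ge0 => j _; rewrite mulr_ge0. Qed.

(** With [q] the weighted count and [g] the discount, the difference is
    [- (q theta_h + g t) / ((theta_h + t) t)], where [q <= t] and [g <= 1]. *)
Lemma draw_prob_close h :
  `|draw_prob h - \sum_j W j h * x j| <= err / t%:R.
Proof.
have t0 := time_gt0R; have th0 := theta_gt0 h.
have := Wk_le h; have := discount_le1 h; have := discount_ge0 h.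
have -> : \sum_j W j h * x j = (\sum_j W j h * (k j)%:R) / t%:R.
  by rewrite mulr_suml; apply: eq_bigr => j _; rewrite mulrA.
have q0 : 0 <= \sum_j W j h * (k j)%:R.
  by apply: sumr_ge0 => j _; rewrite mulr_ge0 ?W_ge0.
rewrite /draw_prob /weight.
move: (\sum_j Gamma j h * _) (\sum_j W j h * _) q0 => g q q0 g0 g1 qt.
have tt0 : 0 < theta h + t%:R by rewrite addr_gt0.
have dE : (q - g) / (theta h + t%:R) - q / t%:R =
    - ((q * theta h + g * t%:R) / (theta h + t%:R) / t%:R).
  by field; rewrite !gt_eqF.
rewrite dE normrN ger0_norm; last first.
  apply: divr_ge0; last exact: ltW.
  apply: divr_ge0; last exact: ltW.
  by apply: addr_ge0; apply: mulr_ge0 => //; exact: ltW.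
rewrite ler_pM2r ?invr_gt0// ler_pdivrMr//.
apply: (@le_trans _ _ ((1 + theta h) * (theta h + t%:R))).
  move: t0 qt; move: t%:R => s s0 qs; nra.
by rewrite ler_pM2r// /err lerD2l theta_le_sum.
Qed.

(** By stationarity [W x] and [x] have the same [pi]-average, so only the error of [draw_prob_close]
    survives: the mean frequency is almost a martingale. *)
Lemma mean_prob_close :
  `|\sum_h pi h * (draw_prob h - x h)| <= err / t%:R.
Proof.
have -> : \sum_h pi h * (draw_prob h - x h) =
    \sum_h pi h * (draw_prob h - \sum_j W j h * x j).
  under eq_bigr do rewrite mulrBr; under [RHS]eq_bigr do rewrite mulrBr.
  rewrite !sumrB; congr (_ - _).
  under [RHS]eq_bigr do rewrite mulr_sumr.
  rewrite exchange_big/=; apply: eq_bigr => j _.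
  by rewrite -{1}pi_stat mulr_suml; apply: eq_bigr => h _; ring.
exact/pi_average_norm/draw_prob_close.
Qed.

(** Expanding the square, the terms in [x h ^ 2] give one energy through the column sums of [W], and
    those in [x j ^ 2] give another through stationarity. *)
Lemma dirichletE : dirichlet t k =
  2 * energy t k - 2 * \sum_h pi h * (x h * \sum_j W j h * x j).
Proof.
have -> : dirichlet t k = \sum_h \sum_j pi h * W j h * x h ^+ 2 +
    \sum_h \sum_j pi h * W j h * x j ^+ 2 -
    2 * \sum_h pi h * (x h * \sum_j W j h * x j).
  rewrite mulr_sumr -big_split/= -sumrB; apply: eq_bigr => h _.
  rewrite mulr_sumr mulr_sumr mulr_sumr -big_split/= -sumrB.
  by apply: eq_bigr => j _; ring.
congr (_ - _); rewrite mulr_natl mulr2n; congr (_ + _).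
  apply: eq_bigr => h _; rewrite -mulr_suml -mulr_sumr W_col_sum mulr1.
  by [].
rewrite exchange_big/=; apply: eq_bigr => j _; rewrite -mulr_suml.
by congr (_ * _); rewrite -[RHS]pi_stat; apply: eq_bigr => h _; rewrite mulrC.
Qed.

(** If [draw_prob] were exactly [W x], [dirichletE] would give the drift [- dirichlet]; the error is
    an average of [draw_prob_close] with factors [x h <= 1]. *)
Lemma energy_drift :
  2 * \sum_h pi h * (x h * (draw_prob h - x h)) <=
  - dirichlet t k + 2 * (err / t%:R).
Proof.
have -> : \sum_h pi h * (x h * (draw_prob h - x h)) =
    \sum_h pi h * (x h * \sum_j W j h * x j) - energy t k +
    \sum_h pi h * (x h * (draw_prob h - \sum_j W j h * x j)).
  rewrite /energy -sumrB -big_split/=; apply: eq_bigr => h _; ring.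
rewrite dirichletE.
suff : \sum_h pi h * (x h * (draw_prob h - \sum_j W j h * x j)) <= err / t%:R.
  by lra.
apply: pi_average_le => h; apply: le_trans (ler_norm _) _.
rewrite normrM (ger0_norm (freq_ge0 h)) -[leRHS]mul1r.
by apply: ler_pM; rewrite ?freq_ge0 ?freq_le1 ?draw_prob_close.
Qed.

Lemma mass_le : mass k <= t%:R.
Proof. by apply: pi_average_le => h; rewrite ler_nat. Qed.

Lemma mean_weight_ge_mass : mass k - 1 <= \sum_h pi h * weight h.
Proof.
have -> : \sum_h pi h * weight h =
    mass k - \sum_h pi h * \sum_j Gamma j h * (ff j)%:R.
  rewrite /weight; under eq_bigr do rewrite mulrBr.
  rewrite sumrB; congr (_ - _).
  under eq_bigr do rewrite mulr_sumr.
  rewrite exchange_big/=; apply: eq_bigr => j _.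
  by rewrite -pi_stat mulr_suml; apply: eq_bigr => h _; ring.
by rewrite lerB// pi_average_le// => h; exact: discount_le1.
Qed.

(** The urn [j] that first drew the color has [k j >= 1], so its own term is [Gamma j j * (k j - 1)
    + Lambda j j * k j >= Lambda j j]. The positive diagonal of [Lambda] thus bounds the weight
    below even when [mass k - 1] is negative. *)
Lemma mean_weight_ge delta : (forall j, delta <= pi j * Lambda j j) ->
  delta <= \sum_h pi h * weight h.
Proof.
move=> dle; have [j ffj] := ff_ex; apply: le_trans (dle j) _.
rewrite (bigD1 j)//=; apply: ler_wpDr.
  by apply: sumr_ge0 => h _; rewrite mulr_ge0 ?weight_ge0// ltW.
rewrite ler_pM2l// weightE (bigD1 j)//=; apply: ler_wpDr.
  by apply: sumr_ge0 => i _; exact: weight_term_ge0.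
have k1 : 1 <= (k j)%:R :> R.
  by rewrite ler1n; apply: leq_trans (ff_le j); rewrite ffj.
rewrite ffj WE mxE /= mulr1; have := Gamma_ge0 j j; have := Lambda_ge0 j j; nra.
Qed.

Lemma mean_weight_le_mass : \sum_h pi h * weight h <= mass k.
Proof.
have -> : mass k = \sum_h pi h * \sum_j W j h * (k j)%:R.
  under [RHS]eq_bigr do rewrite mulr_sumr.
  rewrite exchange_big/=; apply: eq_bigr => j _.
  by rewrite -pi_stat mulr_suml; apply: eq_bigr => h _; ring.
apply: ler_sum => h _; rewrite ler_pM2l// /weight gerBl.
exact: discount_ge0.
Qed.

Lemma mean_prob_ge :
  (\sum_h pi h * weight h) / (theta_sum + t%:R) <= \sum_h pi h * draw_prob h.
Proof.
rewrite mulr_suml; apply: ler_sum => h _; rewrite -mulrA ler_pM2l//.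
rewrite /draw_prob ler_wpM2l ?weight_ge0// lef_pV2 ?posrE.
- by rewrite lerD2r theta_le_sum.
- by rewrite ltr_wpDl ?theta_sum_ge0 ?time_gt0R.
- by rewrite addr_gt0 ?time_gt0R.
Qed.

(** * Effect of one round of draws *)

Section Draws.
Variable e : 'I_N -> bool.
Let k' h := (k h + e h)%N.
Local Notation s := (t.+1%:R^-1 : R).

Lemma freqS h : freq t.+1 k' h = x h + ((e h)%:R - x h) * s.
Proof.
rewrite /freq /k' natrD -natr1; field.
by rewrite natr1 pnatr_eq0/= gt_eqF// time_gt0R.
Qed.

Lemma increment_le h : `|(e h)%:R - x h| <= 1.
Proof.
have := freq_ge0 h; have := freq_le1 h.
by rewrite ler_norml; case: (e h) => /=; rewrite ?mulr1n ?mulr0n; lra.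
Qed.

Lemma freqS_bounds h : 0 <= freq t.+1 k' h <= 1.
Proof.
rewrite divr_ge0//= ler_pdivrMr ?ltr0n// mul1r ler_nat /k' -addn1.
by rewrite leq_add// leq_b1.
Qed.

(** Each squared difference changes by a product of two factors: a change of at most [2 / (t + 1)]
    and a sum of at most 2. This is the slow variation required by [cvg0_slow_variation]. *)
Lemma dirichlet_step : `|dirichlet t.+1 k' - dirichlet t k| <= 4 / t.+1%:R.
Proof.
pose z h j := (freq t.+1 k' h - freq t.+1 k' j) ^+ 2 - (x h - x j) ^+ 2.
have zb h j : `|z h j| <= 4 / t.+1%:R.
  have s0 : 0 <= s by rewrite invr_ge0.
  have xb := freqS_bounds h; have yb := freqS_bounds j.
  have x0 := freq_ge0 h; have x1 := freq_le1 h.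
  have y0 := freq_ge0 j; have y1 := freq_le1 j.
  have -> : z h j = (((e h)%:R - x h) - ((e j)%:R - x j)) * s *
      ((freq t.+1 k' h - freq t.+1 k' j) + (x h - x j)).
    by rewrite /z subr_sqr; congr (_ * _); rewrite !freqS; ring.
  have -> : 4 / t.+1%:R = 2 * s * 2 by ring.
  rewrite normrM ler_pM//.
    rewrite normrM (ger0_norm s0) ler_wpM2r//.
    apply: le_trans (ler_normB _ _) _.
    by have := lerD (increment_le h) (increment_le j); lra.
  by rewrite ler_norml; lra.
have -> : dirichlet t.+1 k' - dirichlet t k =
    \sum_h pi h * \sum_j W j h * z h j.
  rewrite -sumrB; apply: eq_bigr => h _; rewrite mulr_sumr -sumrB.
  by apply: eq_bigr => j _; rewrite /z; ring.
apply: pi_average_norm => h; apply: le_trans (ler_norm_sum _ _ _) _.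
rewrite -[leRHS]mul1r -[X in _ <= X * _](W_col_sum h) mulr_suml.
by apply: ler_sum => j _; rewrite normrM (ger0_norm (W_ge0 _ _)) ler_wpM2l ?W_ge0.
Qed.

(** The bound is kept affine in the indicators [e h], so that in expectation each of them can be
    replaced by its draw probability; the quadratic part is at most [s ^ 2]. *)
Lemma energy_step : energy t.+1 k' <=
  energy t k + \sum_h 2 * pi h * x h * s * ((e h)%:R - x h) + s ^+ 2.
Proof.
have -> : energy t.+1 k' = energy t k +
    \sum_h 2 * pi h * x h * s * ((e h)%:R - x h) +
    \sum_h pi h * (((e h)%:R - x h) * s) ^+ 2.
  rewrite /energy -!big_split/=; apply: eq_bigr => h _.
  by rewrite freqS; ring.
rewrite lerD2l; apply: pi_average_le => h; rewrite exprMn ler_piMl ?sqr_ge0//.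
by rewrite -real_normK ?num_real// expr_le1// increment_le.
Qed.

Lemma mean_freqS :
  mean_freq t.+1 k' = mean_freq t k + s * \sum_h pi h * ((e h)%:R - x h).
Proof.
rewrite /mean_freq mulr_sumr -big_split/=; apply: eq_bigr => h _.
by rewrite freqS; ring.
Qed.

Lemma mean_freq_step (m : R) : (mean_freq t.+1 k' - m) ^+ 2 <=
  (mean_freq t k - m) ^+ 2 +
  \sum_h 2 * (mean_freq t k - m) * s * pi h * ((e h)%:R - x h) + s ^+ 2.
Proof.
have -> : \sum_h 2 * (mean_freq t k - m) * s * pi h * ((e h)%:R - x h) =
    2 * (mean_freq t k - m) * s * \sum_h pi h * ((e h)%:R - x h).
  by rewrite mulr_sumr; apply: eq_bigr => h _; ring.
have := @pi_average_norm (fun h => (e h)%:R - x h) 1 increment_le.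
rewrite mean_freqS; move: (\sum_h _) => z /= z1.
have : z ^+ 2 <= 1 by rewrite -real_normK ?num_real// expr_le1.
have : 0 <= s ^+ 2 by exact: sqr_ge0.
move: s => q; nra.
Qed.

Hypothesis mass_gt0 : 0 < mass k.

Lemma massS : mass k' = mass k + \sum_h pi h * (e h)%:R.
Proof.
rewrite /mass -big_split/=; apply: eq_bigr => h _.
by rewrite /k' natrD mulrDr.
Qed.

(** Let [z] be the increase of the mass, [0 <= z <= 1]. Each part is bounded by an affine function
    of [z]: the inverse of [S + z] by its chord on [[0, 1]], and the logarithms by
    [ln (1 + y) <= y]. *)
Lemma potential_step kappa : 0 <= kappa ->
  potential kappa t.+1 k' <=
  potential kappa t k + (theta_sum + t%:R)^-1 +
  \sum_h - pi h * ((mass k + 1)^-1 + kappa / (mass k * (mass k + 1))) *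
    (e h)%:R.
Proof.
move=> kap0.
have -> : \sum_h - pi h * ((mass k + 1)^-1 + kappa / (mass k * (mass k + 1))) *
    (e h)%:R = - ((mass k + 1)^-1 + kappa / (mass k * (mass k + 1))) *
    \sum_h pi h * (e h)%:R.
  by rewrite mulr_sumr; apply: eq_bigr => h _; ring.
have z0 : 0 <= \sum_h pi h * (e h)%:R.
  by apply: sumr_ge0 => h _; rewrite mulr_ge0// ltW.
have z1 : \sum_h pi h * (e h)%:R <= 1.
  by apply: pi_average_le => h; case: (e h).
rewrite /potential massS; move: (\sum_h _) z0 z1 => z z0 z1.
have u0 : 0 < theta_sum + t%:R by rewrite ltr_wpDl ?theta_sum_ge0 ?time_gt0R.
have -> : theta_sum + t.+1%:R = (theta_sum + t%:R) + 1 by rewrite -natr1 addrA.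
move: (theta_sum + t%:R) (mass k) mass_gt0 u0 => u S S0 u0.
have Sz : 0 < S + z by lra.
have S1 : 0 < S + 1 by lra.
have inv_step : (S + z)^-1 <= S^-1 - z / (S * (S + 1)).
  rewrite -subr_ge0.
  have -> : S^-1 - z / (S * (S + 1)) - (S + z)^-1 =
      z * (1 - z) / (S * (S + z) * (S + 1)) by field; rewrite !gt_eqF.
  by rewrite divr_ge0 ?mulr_ge0 ?subr_ge0// ltW.
have ln_time : ln (u + 1) <= ln u + u^-1.
  have -> : u + 1 = u * (1 + u^-1) by field; rewrite gt_eqF.
  have u10 : 0 < u^-1 by rewrite invr_gt0.
  rewrite lnM ?posrE ?addr_gt0// lerD2l le_ln1Dx//; lra.
have ln_mass : ln S + z / (S + 1) <= ln (S + z).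
  have -> : ln S = ln (S + z) + ln (1 + - (z / (S + z))).
    rewrite -lnM ?posrE//.
      by congr ln; field; rewrite gt_eqF.
    have -> : 1 + - (z / (S + z)) = S / (S + z) by field; rewrite gt_eqF.
    by rewrite divr_gt0.
  rewrite -addrA gerDl.
  have zz : z / (S + 1) <= z / (S + z).
    by rewrite ler_wpM2l// lef_pV2 ?posrE// lerD2l.
  have : ln (1 + - (z / (S + z))) <= - (z / (S + z)).
    apply: le_ln1Dx; rewrite ltrN2 ltr_pdivrMr//; lra.
  lra.
have u1 : 0 < u + 1 by lra.
rewrite (ln_div _ Sz) ?posrE// (ln_div _ S0) ?posrE//.
have := ler_wpM2l kap0 inv_step; rewrite mulrBr => kS.
lra.
Qed.

End Draws.

(** With mean weight [n] and mass [S], the claim reduces to [S n + kappa n >= S (S + 1)]. Since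
    [n >= S - 1], the first term misses at most [2 S]. The second covers it: [2 n >= 2 S - 2] and
    [2 n / delta >= 2], whence the value of [kappa]. *)
Lemma potential_drift delta kappa :
  0 < delta -> (forall j, delta <= pi j * Lambda j j) ->
  kappa = 2 * (1 + delta^-1) ->
  potential kappa t k + (theta_sum + t%:R)^-1 +
  \sum_h - pi h * ((mass k + 1)^-1 + kappa / (mass k * (mass k + 1))) *
    draw_prob h <= potential kappa t k.
Proof.
move=> delta0 dle kappaE.
have -> : \sum_h - pi h * ((mass k + 1)^-1 + kappa / (mass k * (mass k + 1))) *
    draw_prob h = - ((mass k + 1)^-1 + kappa / (mass k * (mass k + 1))) *
    \sum_h pi h * draw_prob h.
  by rewrite mulr_sumr; apply: eq_bigr => h _; ring.
have nd := mean_weight_ge dle; have nS := mean_weight_ge_mass.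
have n_le := mean_weight_le_mass; have pn := mean_prob_ge.
have u0 : 0 < theta_sum + t%:R by rewrite ltr_wpDl ?theta_sum_ge0 ?time_gt0R.
rewrite -addrA gerDl.
move: (theta_sum + t%:R) (mass k) (\sum_h pi h * weight h)
  (\sum_h pi h * draw_prob h) u0 nd nS n_le pn => u S n p u0 nd nS n_le pn.
have S0 : 0 < S by lra.
have S1 : 0 < S + 1 by lra.
have kap0 : 0 < kappa by rewrite kappaE mulr_gt0// addr_gt0// invr_gt0.
have c0 : 0 <= (S + 1)^-1 + kappa / (S * (S + 1)).
  by rewrite addr_ge0 ?divr_ge0 ?mulr_ge0 ?invr_ge0// ltW.
have kn : 2 * S <= kappa * n.
  have : 1 <= delta^-1 * n by rewrite mulrC ler_pdivlMr// mul1r.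
  by rewrite kappaE; nra.
have -> : u^-1 + - ((S + 1)^-1 + kappa / (S * (S + 1))) * p =
  (u^-1 - ((S + 1)^-1 + kappa / (S * (S + 1))) * (n / u)) -
  ((S + 1)^-1 + kappa / (S * (S + 1))) * (p - n / u) by ring.
have c1 : 0 <= ((S + 1)^-1 + kappa / (S * (S + 1))) * (p - n / u).
  by rewrite mulr_ge0// subr_ge0.
suff : u^-1 - ((S + 1)^-1 + kappa / (S * (S + 1))) * (n / u) <= 0 by lra.
have -> : u^-1 - ((S + 1)^-1 + kappa / (S * (S + 1))) * (n / u) =
    - ((S * n + kappa * n - S * (S + 1)) / (u * (S * (S + 1)))).
  by field; rewrite !gt_eqF.
have SnS : 0 <= S * (n - (S - 1)) by rewrite mulr_ge0 ?subr_ge0// ltW.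
rewrite oppr_le0; apply: divr_ge0.
  by move: kn SnS; move: (kappa * n) => q kn SnS; nra.
by apply: mulr_ge0; [exact: ltW|apply: mulr_ge0; exact: ltW].
Qed.

Lemma potential_ge0 kappa : 0 <= kappa -> 0 < mass k -> 0 <= potential kappa t k.
Proof.
move=> kap0 S0; apply: addr_ge0; last by apply: divr_ge0 => //; exact: ltW.
apply: ln_ge0.
rewrite ler_pdivlMr// mul1r; apply: le_trans mass_le _.
by rewrite lerDr theta_sum_ge0.
Qed.

End AtTime.
End UrnVectors.

(** * Almost sure behaviour of the counts *)

Section InteractingUrns.
Variables (R : realType) (d : measure_display) (T : measurableType d).
Variables (P : probability T R) (N : nat) (theta : 'I_N -> R).
Variables (Gamma Lambda W : 'M[R]_N) (C : nat -> 'I_N -> T -> nat).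
Variable pi : 'I_N -> R.
Hypothesis theta_gt0 : forall h, 0 < theta h.
Hypothesis Gamma_ge0 : forall j h, 0 <= Gamma j h.
Hypothesis Lambda_ge0 : forall j h, 0 <= Lambda j h.
Hypothesis WE : W = Gamma + Lambda.
Hypothesis W_col_sum : forall h, \sum_(j < N) W j h = 1.
Hypothesis Gamma_col_sum : forall h, \sum_(j < N) Gamma j h < 1.
Hypothesis pi_gt0 : forall h, 0 < pi h.
Hypothesis pi_sum : \sum_(h < N) pi h = 1.
Hypothesis pi_stat : forall j, \sum_(h < N) W j h * pi h = pi j.
Hypothesis C_meas : forall t h c, measurable [set w | C t h w = c].
Hypothesis dynamics : forall t (H : nat -> 'I_N -> nat) (y : 'I_N -> option nat),
  (forall h c, y h = Some c -> old H t c) ->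
  P (hist_ev C t H `&` [set w | forall h, typ C t h w = y h]) =
  (P (hist_ev C t H) * (\prod_(h < N) kern theta Gamma W H t h (y h))%:E)%E.

Variable c : nat.

Definition color_count t (w : T) : 'I_N -> nat := fun j => Kc (histw C w) t j c.
Definition first_urn t (w : T) : 'I_N -> bool :=
  fun j => firstfrom (histw C w) t j c.
Definition seen tau (w : T) : R := (old (histw C w) tau c)%:R.

Definition adapted_bounded t (f : T -> R) :=
  adapted C t f /\ exists B, forall w, `|f w| <= B.

Lemma adapted_bounded_mono t t' f :
  (t <= t')%N -> adapted_bounded t f -> adapted_bounded t' f.
Proof. by move=> tt' [af bf]; split => //; exact: adapted_mono af. Qed.

Lemma adapted_boundedW t f : adapted_bounded t f -> bounded_mfun f.
Proof. by move=> [af [B bf]]; apply: adapted_bounded_mfun bf => //; exact: af. Qed.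

Lemma adapted_bounded_cst t (r : R) : adapted_bounded t (fun=> r).
Proof. by split => //; exists `|r|. Qed.

Lemma adapted_boundedD t f g : adapted_bounded t f -> adapted_bounded t g ->
  adapted_bounded t (fun w => f w + g w).
Proof.
move=> [af [B bf]] [ag [B' bg]]; split.
  by move=> w w' ww'; rewrite (af _ _ ww') (ag _ _ ww').
by exists (B + B') => w; apply: le_trans (ler_normD _ _) _; exact: lerD.
Qed.

Lemma adapted_boundedM t f g : adapted_bounded t f -> adapted_bounded t g ->
  adapted_bounded t (fun w => f w * g w).
Proof.
move=> [af [B bf]] [ag [B' bg]]; split.
  by move=> w w' ww'; rewrite (af _ _ ww') (ag _ _ ww').
by exists (B * B') => w; rewrite normrM; exact: ler_pM.
Qed.

Lemma adapted_boundedN t f : adapted_bounded t f ->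
  adapted_bounded t (fun w => - f w).
Proof.
move=> [af [B bf]]; split; last by exists B => w; rewrite normrN.
by move=> w w' ww'; rewrite (af _ _ ww').
Qed.

Lemma adapted_bounded_norm t f : adapted_bounded t f ->
  adapted_bounded t (fun w => `|f w|).
Proof.
move=> [af [B bf]]; split; last by exists B => w; rewrite normr_id.
by move=> w w' ww'; rewrite (af _ _ ww').
Qed.

Lemma adapted_bounded_sum t (I : finType) (f : I -> T -> R) :
  (forall i, adapted_bounded t (f i)) ->
  adapted_bounded t (fun w => \sum_i f i w).
Proof.
move=> af; have -> : (fun w => \sum_i f i w) = \sum_i f i.
  by apply/funext => w; rewrite fct_sumE.
apply: (big_ind (adapted_bounded t)) => //; first exact: adapted_bounded_cst.
by move=> ? ?; exact: adapted_boundedD.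
Qed.

(* At time [t] the count vector only takes finitely many values. *)
Lemma adapted_bounded_count t (phi : ('I_N -> nat) -> R) :
  adapted_bounded t (fun w => phi (color_count t w)).
Proof.
split.
  move=> w w' ww'; congr phi; apply/funext => j; exact: adapted_Kc.
pose F (g : {ffun 'I_N -> 'I_t.+1}) := phi (fun j => val (g j)).
exists (\sum_g `|F g|) => w.
have -> : phi (color_count t w) = F [ffun j => inord (color_count t w j)].
  congr phi; apply/funext => j; rewrite ffunE /= inordK// ltnS.
  exact: Kc_le.
by rewrite (bigD1 [ffun j => inord (color_count t w j)])//= lerDl sumr_ge0.
Qed.

Lemma adapted_bounded_seen tau t : (tau <= t)%N -> adapted_bounded t (seen tau).
Proof.
move=> taut; apply: adapted_bounded_mono taut _; split.
  by move=> w w' ww'; rewrite /seen (adapted_old c ww').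
by exists 1 => w; rewrite /seen; case: old; rewrite ?normr1 ?normr0.
Qed.

Lemma adapted_bounded_drawn t h : adapted_bounded t.+1 (drawn R C t h c).
Proof.
split; first exact: adapted_drawn.
by exists 1 => w; rewrite /drawn; case: (_ == _); rewrite ?normr1 ?normr0.
Qed.

Lemma adapted_bounded_Pold t h :
  adapted_bounded t (fun w => Pold theta Gamma W (histw C w) t h c).
Proof.
apply: adapted_boundedM; last exact: adapted_bounded_cst.
apply: adapted_boundedD.
  apply: adapted_bounded_sum => j; apply: adapted_boundedM.
    exact: adapted_bounded_cst.
  exact: (adapted_bounded_count _ (fun k => (k j)%:R)).
apply: adapted_boundedN; apply: adapted_bounded_sum => j.
apply: adapted_boundedM; first exact: adapted_bounded_cst.
split; first by move=> w w' ww'; rewrite (adapted_firstfrom j c ww').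
by exists 1 => w; case: firstfrom; rewrite ?normr1 ?normr0.
Qed.

(** Common pattern of the three drift estimates: a bound affine in the draws, with adapted
    coefficients, is integrated by replacing each indicator with [Pold]. Linearity is why the
    marginal laws of the draws suffice. *)
Lemma drift_le t tau t' (Y Z f : T -> R) (b : 'I_N -> T -> R) :
  (tau <= t)%N ->
  adapted_bounded t' Y -> adapted_bounded t Z -> adapted_bounded t f ->
  (forall h, adapted_bounded t (b h)) ->
  (forall w, old (histw C w) tau c ->
     Y w <= f w + \sum_h b h w * drawn R C t h c w) ->
  (forall w, old (histw C w) tau c ->
     f w + \sum_h b h w * Pold theta Gamma W (histw C w) t h c <= Z w) ->
  (\int[P]_w (seen tau w * Y w) <= \int[P]_w (seen tau w * Z w))%R.
Proof.
move=> taut aY aZ af ab Yle leZ.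
have aS := adapted_bounded_seen taut.
have tt1 := leqnSn t.
have bmS := adapted_boundedW aS.
have bmf := adapted_boundedW (adapted_boundedM aS af).
have bmb h := adapted_boundedM aS (ab h).
have bmd h : bounded_mfun (fun w => seen tau w * b h w * drawn R C t h c w).
  by apply: bounded_mfunM; [exact: adapted_boundedW (bmb h)|
    exact: adapted_boundedW (adapted_bounded_drawn t h)].
have bmp h : bounded_mfun (fun w => seen tau w * b h w *
    Pold theta Gamma W (histw C w) t h c).
  by apply: bounded_mfunM; [exact: adapted_boundedW (bmb h)|
    exact: adapted_boundedW (adapted_bounded_Pold t h)].
have E1 : (\int[P]_w (seen tau w * Y w) <=
    \int[P]_w (seen tau w * f w +
      \sum_h seen tau w * b h w * drawn R C t h c w))%R.
  apply: expect_le.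
  - exact: bounded_mfunM (adapted_boundedW aY).
  - by apply: bounded_mfunD => //; exact: bounded_mfun_sum.
  - move=> w; under eq_bigr do rewrite -mulrA.
    rewrite -mulr_sumr -mulrDr /seen; case: (boolP (old _ _ _)) => [oldw|_].
      by rewrite !mul1r Yle.
    by rewrite !mul0r.
apply: le_trans E1 _.
have E2 : (\int[P]_w (seen tau w * f w + \sum_h seen tau w * b h w *
    Pold theta Gamma W (histw C w) t h c) <= \int[P]_w (seen tau w * Z w))%R.
  apply: expect_le.
  - by apply: bounded_mfunD => //; exact: bounded_mfun_sum.
  - exact: bounded_mfunM (adapted_boundedW aZ).
  - move=> w; under eq_bigr do rewrite -mulrA.
    rewrite -mulr_sumr -mulrDr /seen; case: (boolP (old _ _ _)) => [oldw|_].
      by rewrite !mul1r leZ.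
    by rewrite !mul0r.
apply: le_trans _ E2; rewrite le_eqVlt; apply/orP; left; apply/eqP.
rewrite !expectD//; [|exact: bounded_mfun_sum..].
congr (_ + _); rewrite !expect_sum//; apply: eq_bigr => h _.
have [abh [B bB]] := bmb h.
apply: (expect_step theta_gt0 W_col_sum C_meas dynamics abh bB _ (bmp h)).
move=> w nold; rewrite /seen; case: (boolP (old _ _ _)); last by rewrite mul0r.
by move=> /(old_mono taut); rewrite (negPf nold).
Qed.

Lemma color_count_facts t w : old (histw C w) t c ->
  [/\ forall j, (first_urn t w j <= color_count t w j)%N,
      forall j, (color_count t w j <= t)%N & exists j, first_urn t w j].
Proof.
move=> oldt; split=> [j|j|]; first exact: firstfrom_le_Kc.
  exact: Kc_le.
exact: old_firstfrom.
Qed.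

Lemma color_countS t w : color_count t.+1 w = fun h => (color_count t w h + (C t h w == c))%N.
Proof. by apply/funext => h; exact: KcS. Qed.

Lemma old_time_gt0 tau w : old (histw C w) tau c -> (0 < tau)%N.
Proof. by case: tau => // /oldP[n [j []]]. Qed.

Lemma expect_seen_cst_le tau (r : R) : 0 <= r ->
  (\int[P]_w (seen tau w * r))%R <= r.
Proof.
move=> r0; rewrite -[leRHS](expect_cst P); apply: expect_le.
- apply: bounded_mfunM; last exact: bounded_mfun_cst.
  exact: adapted_boundedW (adapted_bounded_seen (leqnn tau)).
- exact: bounded_mfun_cst.
- by move=> w; rewrite /seen; case: old; rewrite ?mul1r ?mul0r.
Qed.

(** * Expected one-step changes of energy, mean frequency and potential *)

Local Notation err := (err theta).

Lemma err_ge0 : 0 <= err.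
Proof. by rewrite addr_ge0// theta_sum_ge0. Qed.

Lemma inv_time_le t : (0 < t)%N -> t.+1%:R^-1 <= t%:R^-1 :> R.
Proof. by move=> t0; rewrite lef_pV2 ?posrE ?ltr0n// ler_nat. Qed.

(** In the constant, [2 * err] comes from the drift error and 1 from the quadratic term; both carry
    a factor at most [1 / t ^ 2] because [1 / (t + 1) <= 1 / t]. *)
Lemma energy_expect tau t : (tau <= t)%N ->
  (\int[P]_w (seen tau w * energy pi t.+1 (color_count t.+1 w)) <=
   \int[P]_w (seen tau w * (energy pi t (color_count t w) -
     dirichlet W pi t (color_count t w) / t.+1%:R +
     (2 * err + 1) * t%:R^-1 ^+ 2)))%R.
Proof.
move=> taut.
pose s : R := t.+1%:R^-1.
pose b h k := 2 * pi h * freq R t k h * s.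
apply: (drift_le (t := t) (t' := t.+1)
  (f := fun w => energy pi t (color_count t w) + s ^+ 2 -
          \sum_h b h (color_count t w) * freq R t (color_count t w) h)
  (b := fun h w => b h (color_count t w))) => //.
- exact: (adapted_bounded_count t.+1 (energy pi t.+1)).
- exact: (adapted_bounded_count t (fun k => energy pi t k -
    dirichlet W pi t k / t.+1%:R + (2 * err + 1) * t%:R^-1 ^+ 2)).
- exact: (adapted_bounded_count t (fun k => energy pi t k + s ^+ 2 -
    \sum_h b h k * freq R t k h)).
- by move=> h; exact: (adapted_bounded_count t (b h)).
- move=> w /(old_mono taut)/color_count_facts[ffk kt ffe]; rewrite color_countS.
  apply: le_trans (energy_step pi_gt0 pi_sum ffk kt ffe _) _.
  under eq_bigr do rewrite mulrBr.
  rewrite sumrB /drawn /b -/s; lra.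
- move=> w oldw; have tau0 := old_time_gt0 oldw.
  move: oldw => /(old_mono taut)/color_count_facts[ffk kt ffe].
  have drift := energy_drift theta_gt0 Gamma_ge0 Lambda_ge0 WE W_col_sum
    Gamma_col_sum pi_gt0 pi_sum pi_stat ffk kt ffe.
  have t0 : (0 < t)%N by exact: leq_trans taut.
  set k := color_count t w in drift *.
  have -> : energy pi t k + s ^+ 2 - \sum_h b h k * freq R t k h +
      \sum_h b h k * Pold theta Gamma W (histw C w) t h c =
    energy pi t k + s ^+ 2 + s * (2 * \sum_h pi h * (freq R t k h *
      (draw_prob theta Gamma W t k (first_urn t w) h - freq R t k h))).
    rewrite addrAC -!addrA; congr (_ + (_ + _)); rewrite -sumrN -big_split/=.
    rewrite !mulr_sumr; apply: eq_bigr => h _; rewrite /b.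
    (* By definition [Pold] of the history is [draw_prob] of its count and first-urn vectors. *)
    rewrite [Pold _ _ _ _ _ _ _](_ : _ =
      draw_prob theta Gamma W t k (first_urn t w) h)//; ring.
  have s0 : 0 <= s by rewrite invr_ge0.
  have st : s <= t%:R^-1 by exact: inv_time_le.
  have := ler_wpM2l s0 drift; rewrite [_ / t.+1%:R](mulrC _ s) -/s.
  have e0 := err_ge0.
  clear b drift; clearbody s.
  move: (\sum_h _) (dirichlet _ _ _ _) => q D; move: st s0.
  move: t%:R^-1 => r sr s0 drift.
  have : s * (2 * (err * r)) <= 2 * err * r ^+ 2.
    have : 0 <= err * r * (r - s) by rewrite !mulr_ge0//; lra.
    by lra.
  have : s ^+ 2 <= r ^+ 2 by rewrite ler_pXn2r ?nnegrE//; lra.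
  lra.
Qed.

Definition deviation m t (w : T) : R :=
  mean_freq pi t (color_count t w) - mean_freq pi m (color_count m w).

Lemma adapted_bounded_deviation m n : (m <= n)%N ->
  adapted_bounded n (deviation m n).
Proof.
move=> mn; apply: adapted_boundedD.
  exact: (adapted_bounded_count n (mean_freq pi n)).
apply: adapted_boundedN; apply: adapted_bounded_mono mn _.
exact: (adapted_bounded_count m (mean_freq pi m)).
Qed.

(** The deviation is at most 1 in absolute value and the mean drift is at most [err / t], so each
    step adds [O(1 / t ^ 2)]; bounding by [1 / m ^ 2] makes the cost uniform over [t >= m]. *)
Lemma mean_freq_expect tau m t : (tau <= m)%N -> (m <= t)%N ->
  (\int[P]_w (seen tau w * deviation m t.+1 w ^+ 2) <=
   \int[P]_w (seen tau w * (deviation m t w ^+ 2 +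
     (2 * err + 1) * m%:R^-1 ^+ 2)))%R.
Proof.
move=> taum mt; pose dev := deviation m.
have taut := leq_trans taum mt.
pose s : R := t.+1%:R^-1.
pose b h w := 2 * dev t w * s * pi h.
have adev n : (m <= n)%N -> adapted_bounded n (dev n).
  exact: adapted_bounded_deviation.
have ab h : adapted_bounded t (b h).
  apply: adapted_boundedM; last exact: adapted_bounded_cst.
  apply: adapted_boundedM; last exact: adapted_bounded_cst.
  by apply: adapted_boundedM; [exact: adapted_bounded_cst|exact: adev].
have ax h : adapted_bounded t (fun w => freq R t (color_count t w) h).
  exact: (adapted_bounded_count t (fun k => freq R t k h)).
apply: (drift_le (t := t) (t' := t.+1)
  (f := fun w => dev t w ^+ 2 + s ^+ 2 -
          \sum_h b h w * freq R t (color_count t w) h) (b := b)) => //.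
- by apply: adapted_boundedM; apply: adev; exact: leqW.
- apply: adapted_boundedD; last exact: adapted_bounded_cst.
  by apply: adapted_boundedM; exact: adev.
- apply: adapted_boundedD.
    apply: adapted_boundedD; last exact: adapted_bounded_cst.
    by apply: adapted_boundedM; exact: adev.
  apply: adapted_boundedN; apply: adapted_bounded_sum => h.
  exact: adapted_boundedM.
- move=> w /(old_mono taut)/color_count_facts[ffk kt ffe]; rewrite /dev /deviation color_countS.
  apply: le_trans (mean_freq_step pi_gt0 pi_sum ffk kt ffe _ _) _.
  under eq_bigr do rewrite mulrBr.
  rewrite sumrB /drawn /b /dev /deviation -/s; lra.
- move=> w oldw; have tau0 := old_time_gt0 oldw.
  have := oldw; move=> /(old_mono taum)/color_count_facts[ffkm ktm ffem].
  move: oldw => /(old_mono taut)/color_count_facts[ffk kt ffe].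
  have drift := mean_prob_close theta_gt0 Gamma_ge0 Lambda_ge0 WE W_col_sum
    Gamma_col_sum pi_gt0 pi_sum pi_stat ffk kt ffe.
  have t0 : (0 < t)%N by exact: leq_trans taut.
  have m0 : (0 < m)%N by exact: leq_trans taum.
  have dev1 : `|dev t w| <= 1.
    have M01 n : (forall j, (color_count n w j <= n)%N) ->
        (exists j, first_urn n w j) ->
        (forall j, (first_urn n w j <= color_count n w j)%N) ->
        0 <= mean_freq pi n (color_count n w) <= 1.
      move=> kn fe fk; apply/andP; split.
        by apply: (pi_average_ge pi_gt0 pi_sum) => h; exact: freq_ge0.
      apply: (pi_average_le pi_gt0 pi_sum) => h.
      exact: freq_le1 fk kn fe h.
    have := M01 _ kt ffe ffk; have := M01 _ ktm ffem ffkm.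
    by rewrite ler_norml /dev /deviation; lra.
  set k := color_count t w in drift *.
  have -> : dev t w ^+ 2 + s ^+ 2 - \sum_h b h w * freq R t k h +
      \sum_h b h w * Pold theta Gamma W (histw C w) t h c =
    dev t w ^+ 2 + s ^+ 2 + 2 * s * (dev t w * \sum_h pi h *
      (draw_prob theta Gamma W t k (first_urn t w) h - freq R t k h)).
    rewrite addrAC -!addrA; congr (_ + (_ + _)); rewrite -sumrN -big_split/=.
    rewrite !mulr_sumr; apply: eq_bigr => h _; rewrite /b.
    rewrite [Pold _ _ _ _ _ _ _](_ : _ =
      draw_prob theta Gamma W t k (first_urn t w) h)//; ring.
  rewrite -addrA lerD2l.
  have s0 : 0 <= s by rewrite invr_ge0.
  have st : s <= t%:R^-1 by exact: inv_time_le.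
  have tm : t%:R^-1 <= m%:R^-1 :> R by rewrite lef_pV2 ?posrE ?ltr0n// ler_nat.
  have e0 := err_ge0.
  have := ler_pM (normr_ge0 _) (normr_ge0 _) dev1 drift.
  rewrite -normrM mul1r => /(le_trans (ler_norm _)).
  move: (dev t w * _) => q; move: st tm s0; clear ab b; clearbody s.
  move: t%:R^-1 m%:R^-1 => r r' sr rr' s0 qr.
  have : s * q <= s * (err * r) by exact: ler_wpM2l.
  have : s * (err * r) <= err * r' ^+ 2.
    have -> : s * (err * r) = err * (s * r) by ring.
    by rewrite ler_wpM2l// expr2 ler_pM//; lra.
  have : s ^+ 2 <= r' ^+ 2 by rewrite ler_pXn2r ?nnegrE//; lra.
  lra.
Qed.

Lemma potential_expect tau t delta kappa : (tau <= t)%N ->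
  0 < delta -> (forall j, delta <= pi j * Lambda j j) ->
  kappa = 2 * (1 + delta^-1) ->
  (\int[P]_w (seen tau w * potential theta pi kappa t.+1 (color_count t.+1 w)) <=
   \int[P]_w (seen tau w * potential theta pi kappa t (color_count t w)))%R.
Proof.
move=> taut delta0 dle kappaE.
pose b h (k : 'I_N -> nat) :=
  - pi h * ((mass pi k + 1)^-1 + kappa / (mass pi k * (mass pi k + 1))).
apply: (drift_le (t := t) (t' := t.+1)
  (f := fun w => potential theta pi kappa t (color_count t w) +
          (theta_sum theta + t%:R)^-1)
  (b := fun h w => b h (color_count t w))) => //.
- exact: (adapted_bounded_count t.+1 (potential theta pi kappa t.+1)).
- exact: (adapted_bounded_count t (potential theta pi kappa t)).
- exact: (adapted_bounded_count t (fun k => potential theta pi kappa t k +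
    (theta_sum theta + t%:R)^-1)).
- by move=> h; exact: (adapted_bounded_count t (b h)).
- move=> w /(old_mono taut)/color_count_facts[ffk kt ffe]; rewrite color_countS.
  apply: (potential_step theta_gt0 pi_gt0 pi_sum ffk kt ffe).
    apply: lt_le_trans (mean_weight_le_mass Gamma_ge0 pi_gt0 pi_stat _ _).
    apply: lt_le_trans delta0 _.
    exact: (mean_weight_ge Gamma_ge0 Lambda_ge0 WE pi_gt0 ffk ffe dle).
  by rewrite kappaE mulr_ge0// addr_ge0// invr_ge0 ltW.
- move=> w /(old_mono taut)/color_count_facts[ffk kt ffe].
  exact: (potential_drift theta_gt0 Gamma_ge0 Lambda_ge0 WE Gamma_col_sum
    pi_gt0 pi_sum pi_stat ffk kt ffe delta0 dle kappaE).
Qed.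

(** * Almost sure convergence once the color has appeared *)

Lemma dirichlet_ge0 t k : 0 <= dirichlet W pi t k.
Proof.
apply: sumr_ge0 => h _; apply: sumr_ge0 => j _.
rewrite mulr_ge0 ?sqr_ge0// mulr_ge0 ?(ltW (pi_gt0 _))//.
exact: W_ge0 Gamma_ge0 Lambda_ge0 WE _ _.
Qed.

Lemma seen_ge0 tau w : 0 <= seen tau w.
Proof. by rewrite /seen; case: old. Qed.

Lemma inv_shift_sqr_le tau k : (0 < tau)%N ->
  (k + tau)%:R^-1 ^+ 2 <= k.+1%:R^-1 ^+ 2 :> R.
Proof.
move=> tau0; rewrite ler_pXn2r ?nnegrE ?invr_ge0//.
by rewrite lef_pV2 ?posrE ?ltr0n ?addn_gt0 ?tau0 ?orbT// ler_nat -addn1 leq_add2l.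
Qed.

Lemma ae_dirichlet_cvg0 tau : (0 < tau)%N ->
  {ae P, forall w, old (histw C w) tau c ->
    (fun t => dirichlet W pi t (color_count t w)) @ \oo --> (0 : R)}.
Proof.
move=> tau0.
pose en n w := seen tau w * energy pi (n + tau) (color_count (n + tau) w).
pose f n w := seen tau w *
  (dirichlet W pi (n + tau) (color_count (n + tau) w) / (n + tau).+1%:R).
pose c1 := 2 * err + 1.
have bS : bounded_mfun (seen tau).
  exact: adapted_boundedW (adapted_bounded_seen (leqnn tau)).
have bf n : bounded_mfun (f n).
  apply: bounded_mfunM => //.
  exact: adapted_boundedW (adapted_bounded_count (n + tau)
    (fun k => dirichlet W pi (n + tau) k / (n + tau).+1%:R)).
have ben n : bounded_mfun (en n).
  apply: bounded_mfunM => //.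
  exact: adapted_boundedW (adapted_bounded_count (n + tau) (energy pi (n + tau))).
have c1_ge0 : 0 <= c1 by have := err_ge0; rewrite /c1; lra.
have step n : (\int[P]_w en n.+1 w)%R + (\int[P]_w f n w)%R <=
    (\int[P]_w en n w)%R + c1 * n.+1%:R^-1 ^+ 2.
  have := @energy_expect tau (n + tau)%N (leq_addl _ _).
  have -> : (fun w => seen tau w * (energy pi (n + tau) (color_count (n + tau) w) -
      dirichlet W pi (n + tau) (color_count (n + tau) w) / (n + tau).+1%:R +
      (2 * err + 1) * (n + tau)%:R^-1 ^+ 2)) =
    (fun w => (en n w + (-1) * f n w) + seen tau w * (c1 * (n + tau)%:R^-1 ^+ 2)).
    by apply/funext => w; rewrite /en /f /c1; ring.
  rewrite expectD; last 2 first.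
  - apply: bounded_mfunD => //; apply: bounded_mfunM => //.
    exact: bounded_mfun_cst.
  - by apply: bounded_mfunM => //; exact: bounded_mfun_cst.
  rewrite expectD//; last first.
    by apply: bounded_mfunM => //; exact: bounded_mfun_cst.
  rewrite expectZ//.
  have r0 : 0 <= c1 * (n + tau)%:R^-1 ^+ 2 by rewrite mulr_ge0 ?sqr_ge0.
  have := expect_seen_cst_le tau r0.
  have := ler_wpM2l c1_ge0 (inv_shift_sqr_le n tau0).
  have <- : (\int[P]_w en n.+1 w)%R = (\int[P]_w (seen tau w *
    energy pi (n + tau).+1 (color_count (n + tau).+1 w)))%R by [].
  move: (\int[P]_w en n.+1 w)%R (\int[P]_w en n w)%R (\int[P]_w f n w)%R.
  move: (\int[P]_w (seen tau w * _))%R (c1 * n.+1%:R^-1 ^+ 2).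
  move: (c1 * (n + tau)%:R^-1 ^+ 2) => a b q E1 E0 F ab qa EF; lra.
have en_ge0 n : 0 <= (\int[P]_w en n w)%R.
  apply: Rintegral_ge0 => w _; rewrite mulr_ge0 ?seen_ge0//.
  by apply: sumr_ge0 => h _; rewrite mulr_ge0 ?sqr_ge0// ltW.
have sum_le := sum_drift_le c1_ge0 en_ge0 step.
have f0 n w : 0 <= f n w.
  by rewrite mulr_ge0 ?seen_ge0// divr_ge0 ?dirichlet_ge0.
have := ae_bounded_series bf f0 sum_le.
apply: filterS => w [b fb] oldw.
rewrite -(cvg_shiftn tau) /=.
(* The factor [tau + 1] undoes the time shift in the denominators:
   [n + tau + 1 <= (tau + 1) (n + 1)]. *)
apply: (@cvg0_slow_variation _ _ 4 (tau.+1%:R * b)).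
- by move=> n; exact: dirichlet_ge0.
- move=> n; rewrite addSn color_countS.
  have [ffk kt ffe] := color_count_facts (old_mono (leq_addl n tau) oldw).
  apply: le_trans (dirichlet_step Gamma_ge0 Lambda_ge0 WE W_col_sum pi_gt0 pi_sum
    ffk kt ffe _) _.
  by rewrite ler_pM2l// lef_pV2 ?posrE ?ltr0n// ler_nat ltnS leq_addr.
- move=> n; apply: le_trans (ler_wpM2l _ (fb n)) => //.
  rewrite mulr_sumr; apply: ler_sum => k _.
  rewrite /f /seen oldw mul1r mulrCA ler_wpM2l ?dirichlet_ge0//.
  rewrite ler_pdivlMr ?ltr0n// mulrC ler_pdivrMr ?ltr0n// -natrM ler_nat; nia.
Qed.

Lemma deviation_expect tau m j : (tau <= m)%N ->
  (\int[P]_w (seen tau w * deviation m (m + j) w ^+ 2))%R <=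
  j%:R * ((2 * err + 1) * m%:R^-1 ^+ 2).
Proof.
move=> taum; elim: j => [|j IH].
  rewrite mul0r addn0 /deviation.
  under eq_Rintegral do rewrite subrr expr0n mulr0.
  by rewrite expect_cst.
rewrite addnS -natr1 mulrDl mul1r.
apply: le_trans (mean_freq_expect taum (leq_addr j m)) _.
have bS : bounded_mfun (seen tau).
  exact: adapted_boundedW (adapted_bounded_seen (leqnn tau)).
have bd : bounded_mfun (deviation m (m + j)).
  exact: adapted_boundedW (adapted_bounded_deviation (leq_addr j m)).
under eq_Rintegral do rewrite mulrDr.
rewrite expectD; last 2 first.
- apply: bounded_mfunM => //; exact: bounded_mfunM.
- by apply: bounded_mfunM => //; exact: bounded_mfun_cst.
apply: lerD => //; apply: expect_seen_cst_le.
by rewrite mulr_ge0 ?sqr_ge0//; have := err_ge0; lra.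
Qed.

(** The second moment between consecutive cubes is of order [k ^ 2 / k ^ 6]; the inequality
    [|x| <= k ^ 2 x ^ 2 + 1 / k ^ 2] turns it into a summable first moment. *)
Lemma cube_deviation_expect tau k : (0 < tau)%N -> (tau <= k)%N ->
  (\int[P]_w (seen tau w * `|deviation (k ^ 3) (k.+1 ^ 3) w|))%R <=
  (7 * (2 * err + 1) + 1) * k%:R^-1 ^+ 2.
Proof.
move=> tau0 tauk.
have k0 : (0 < k)%N by exact: leq_trans tauk.
have kR : 0 < k%:R :> R by rewrite ltr0n.
have kk3 : (k <= k ^ 3)%N by rewrite !expnS expn0 muln1; nia.
have k3 : (k ^ 3 <= k.+1 ^ 3)%N by rewrite leq_exp2r.
have bS : bounded_mfun (seen tau).
  exact: adapted_boundedW (adapted_bounded_seen (leqnn tau)).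
have bd : bounded_mfun (deviation (k ^ 3) (k.+1 ^ 3)).
  exact: adapted_boundedW (adapted_bounded_deviation k3).
have bd2 : bounded_mfun (fun w => seen tau w * deviation (k ^ 3) (k.+1 ^ 3) w ^+ 2).
  by apply: bounded_mfunM => //; exact: bounded_mfunM.
apply: (@le_trans _ _ (\int[P]_w (k%:R ^+ 2 *
    (seen tau w * deviation (k ^ 3) (k.+1 ^ 3) w ^+ 2) + k%:R^-1 ^+ 2))%R).
  apply: expect_le.
  - apply: bounded_mfunM => //.
    exact: adapted_boundedW (adapted_bounded_norm (adapted_bounded_deviation k3)).
  - apply: bounded_mfunD; last exact: bounded_mfun_cst.
    by apply: bounded_mfunM => //; exact: bounded_mfun_cst.
  - move=> w; rewrite /seen; case: old; last first.
      by rewrite !mul0r mulr0 add0r sqr_ge0.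
    rewrite !mul1r; move: (deviation _ _ w) => x.
    (* AM-GM *)
    rewrite -(real_normK (num_real x)).
    have : 0 <= (k%:R * `|x| - k%:R^-1) ^+ 2 by exact: sqr_ge0.
    have -> : (k%:R * `|x| - k%:R^-1) ^+ 2 =
        k%:R ^+ 2 * `|x| ^+ 2 + k%:R^-1 ^+ 2 - 2 * `|x|.
      by field; rewrite gt_eqF.
    have := normr_ge0 x; lra.
rewrite expectD; last 2 first.
- by apply: bounded_mfunM => //; exact: bounded_mfun_cst.
- exact: bounded_mfun_cst.
rewrite expectZ// expect_cst mulrDl mul1r lerD2r.
have := deviation_expect (k.+1 ^ 3 - k ^ 3) (leq_trans tauk kk3).
rewrite subnKC// => dev_le.
apply: le_trans (ler_wpM2l (sqr_ge0 _) dev_le) _.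
have e0 : 0 <= 2 * err + 1 by have := err_ge0; lra.
have j_le : (k.+1 ^ 3 - k ^ 3)%N%:R <= 7 * k%:R ^+ 2 :> R.
  (* The gap is [3 k ^ 2 + 3 k + 1], at most [7 k ^ 2] since [k >= 1]. *)
  rewrite -natrX -natrM ler_nat leq_subLR !expnS expn0 !muln1; nia.
apply: (@le_trans _ _ (k%:R ^+ 2 *
  (7 * k%:R ^+ 2 * ((2 * err + 1) * (k ^ 3)%:R^-1 ^+ 2)))).
  by rewrite ler_wpM2l ?sqr_ge0// ler_wpM2r// mulr_ge0 ?sqr_ge0.
rewrite natrX le_eqVlt; apply/orP; left; apply/eqP.
by field; rewrite gt_eqF.
Qed.

Lemma mean_freq_increment t w : old (histw C w) t c ->
  `|mean_freq pi t.+1 (color_count t.+1 w) - mean_freq pi t (color_count t w)| <=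
  t.+1%:R^-1.
Proof.
move=> /color_count_facts[ffk kt ffe].
rewrite color_countS (mean_freqS _ ffk kt ffe) addrC addKr normrM ger0_norm ?invr_ge0//.
rewrite ler_piMr ?invr_ge0//; apply: (pi_average_norm pi_gt0 pi_sum) => h.
exact: (increment_le R ffk kt ffe (fun h => C t h w == c) h).
Qed.

Lemma ae_mean_freq_cvg tau : (0 < tau)%N ->
  {ae P, forall w, old (histw C w) tau c ->
    cvgn (fun t => mean_freq pi t (color_count t w))}.
Proof.
move=> tau0.
pose f k w := seen tau w * `|deviation ((k + tau) ^ 3) ((k + tau).+1 ^ 3) w|.
have bf k : bounded_mfun (f k).
  apply: bounded_mfunM.
    exact: adapted_boundedW (adapted_bounded_seen (leqnn tau)).
  apply: adapted_boundedW (adapted_bounded_norm (adapted_bounded_deviation _)).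
  by rewrite leq_exp2r.
have f0 k w : 0 <= f k w by rewrite mulr_ge0// seen_ge0.
pose c2 := 7 * (2 * err + 1) + 1.
have c2_ge0 : 0 <= c2 by have := err_ge0; rewrite /c2; lra.
have sum_le n : \sum_(k < n) (\int[P]_w f k w)%R <= c2 * 2.
  apply: le_trans (ler_wpM2l c2_ge0 (sum_inv_sqr_le R n)).
  rewrite mulr_sumr; apply: ler_sum => k _.
  apply: le_trans (cube_deviation_expect tau0 (leq_addl k tau)) _.
  by rewrite ler_wpM2l// inv_shift_sqr_le.
have := ae_bounded_series bf f0 sum_le.
apply: filterS => w [b fb] oldw.
pose u t := mean_freq pi t (color_count t w).
have : cvgn (fun k => u ((k + tau) ^ 3)%N).
  apply: (@is_cvg_bounded_variation _ _ (f ^~ w) b) => // n.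
  by rewrite /f /seen oldw mul1r addSn.
move=> /cvg_ex[l ul]; apply/cvg_ex; exists l.
apply: (@cvg_cube_interpolation _ u l tau).
  by move=> n taun; apply: mean_freq_increment; exact: old_mono oldw.
by rewrite -(cvg_shiftn tau).
Qed.

(** From time [tau] on, the expected potential restricted to the event is nonincreasing, hence
    bounded by its initial value, and [ae_frequently_bounded] applies. *)
Lemma ae_potential_bounded tau delta kappa :
  0 < delta -> (forall j, delta <= pi j * Lambda j j) ->
  kappa = 2 * (1 + delta^-1) ->
  {ae P, forall w, old (histw C w) tau c ->
    exists b, forall n, exists2 t, (n <= t)%N &
      potential theta pi kappa t (color_count t w) <= b}.
Proof.
move=> delta0 dle kappaE.
pose f n w := seen tau w *
  potential theta pi kappa (n + tau) (color_count (n + tau) w).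
have bf n : bounded_mfun (f n).
  apply: bounded_mfunM.
    exact: adapted_boundedW (adapted_bounded_seen (leqnn tau)).
  exact: adapted_boundedW (adapted_bounded_count (n + tau)
    (potential theta pi kappa (n + tau))).
have f0 n w : 0 <= f n w.
  rewrite /f /seen; case: (boolP (old _ _ _)) => oldw; last by rewrite mul0r.
  have [ffk kt ffe] := color_count_facts (old_mono (leq_addl n tau) oldw).
  rewrite mul1r; apply: (potential_ge0 theta_gt0 pi_gt0 pi_sum kt).
    by rewrite kappaE mulr_ge0// addr_ge0// invr_ge0 ltW.
  apply: lt_le_trans (mean_weight_le_mass Gamma_ge0 pi_gt0 pi_stat _ _).
  apply: lt_le_trans delta0 _.
  exact: (mean_weight_ge Gamma_ge0 Lambda_ge0 WE pi_gt0 ffk ffe dle).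
have f_le n : (\int[P]_w f n w)%R <= (\int[P]_w f 0 w)%R.
  elim: n => // n; apply: le_trans.
  exact: (potential_expect (leq_addl n tau) delta0 dle kappaE).
have := ae_frequently_bounded bf f0 f_le.
apply: filterS => w [b fb] oldw; exists b => n.
have [m nm fm] := fb n; exists (m + tau)%N; first exact: leq_trans (leq_addr _ _).
by move: fm; rewrite /f /seen oldw mul1r.
Qed.

(** * Common limit of the frequencies and its positivity *)

Hypothesis W_irr : irreducible_mx W.

Lemma freq_diff_cvg0 w :
  (fun t => dirichlet W pi t (color_count t w)) @ \oo --> (0 : R) ->
  forall i j, (fun t => freq R t (color_count t w) i - freq R t (color_count t w) j)
    @ \oo --> (0 : R).
Proof.
move=> D0.
have edge a b : 0 < W a b ->
    (fun t => freq R t (color_count t w) a - freq R t (color_count t w) b) @ \oo --> (0 : R).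
  move=> Wab; apply/cvgrPdist_lt => e e0.
  have q0 : 0 < pi b * W a b by rewrite mulr_gt0.
  have : \forall t \near \oo, dirichlet W pi t (color_count t w) < pi b * W a b * e ^+ 2.
    by apply: (cvgr_lt 0) => //; rewrite mulr_gt0// exprn_gt0.
  apply: filterS => t Dt; rewrite sub0r normrN.
  rewrite -(ltr_pXn2r (n := 2))// ?nnegrE ?normr_ge0 ?(ltW e0)//.
  rewrite real_normK ?num_real// -(ltr_pM2l q0).
  (* The single term of the edge, [pi b * W a b * (x b - x a) ^ 2], is below the whole form because
     all the other terms are nonnegative. *)
  apply: le_lt_trans Dt; rewrite -sqrrN opprB /dirichlet (bigD1 b)//= (bigD1 a)//=.
  rewrite -addrA lerDl addr_ge0//.
    apply: sumr_ge0 => j _; rewrite mulr_ge0 ?sqr_ge0// mulr_ge0 ?(ltW (pi_gt0 _))//.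
    exact: W_ge0 Gamma_ge0 Lambda_ge0 WE _ _.
  apply: sumr_ge0 => h _; apply: sumr_ge0 => j _.
  rewrite mulr_ge0 ?sqr_ge0// mulr_ge0 ?(ltW (pi_gt0 _))//.
  exact: W_ge0 Gamma_ge0 Lambda_ge0 WE _ _.
move=> i j; have /connectP[p] := W_irr i j.
elim: p i => [|a p IH] i /=.
  move=> _ ->; under eq_fun do rewrite subrr; exact: cvg_cst.
move=> /andP[Wia pth] lst.
have -> : (fun t => freq R t (color_count t w) i - freq R t (color_count t w) j) =
    (fun t => (freq R t (color_count t w) i - freq R t (color_count t w) a) +
              (freq R t (color_count t w) a - freq R t (color_count t w) j)).
  by apply/funext => t; ring.
rewrite -[0]addr0; apply: cvgD; [exact: edge|exact: IH].
Qed.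

Lemma cvg_sum_ord (u : 'I_N -> nat -> R) (l : 'I_N -> R) :
  (forall j, u j @ \oo --> l j) ->
  (fun t => \sum_j u j t) @ \oo --> \sum_j l j.
Proof.
by move=> ul; apply: cvg_big => [|j _]; [exact: add_continuous|exact: ul].
Qed.

(** Pathwise conclusion: each frequency is the mean frequency minus a [pi]-average of differences
    that tend to 0, so all share the limit of the mean. *)
Lemma freq_cvg w tau kappa : old (histw C w) tau c -> 0 <= kappa ->
  (fun t => dirichlet W pi t (color_count t w)) @ \oo --> (0 : R) ->
  cvgn (fun t => mean_freq pi t (color_count t w)) ->
  (exists b, forall n, exists2 t, (n <= t)%N &
     potential theta pi kappa t (color_count t w) <= b) ->
  exists2 l : R, 0 < l <= 1 &
    forall h, (fun t => freq R t (color_count t w) h) @ \oo --> l.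
Proof.
move=> oldw kap0 D0 /cvg_ex[l Ml] [b Pb].
have M1 t : (tau <= t)%N -> mean_freq pi t (color_count t w) <= 1.
  move=> taut; have [ffk kt ffe] := color_count_facts (old_mono taut oldw).
  by apply: (pi_average_le pi_gt0 pi_sum) => h; exact: freq_le1 ffk kt ffe h.
exists l; last first.
  move=> h.
  have -> : (fun t => freq R t (color_count t w) h) =
      (fun t => mean_freq pi t (color_count t w) -
        \sum_j pi j * (freq R t (color_count t w) j - freq R t (color_count t w) h)).
    apply/funext => t; under eq_bigr do rewrite mulrBr.
    by rewrite sumrB -mulr_suml pi_sum mul1r opprB addrC subrK.
  rewrite -[X in _ --> X]subr0; apply: cvgB => //.
  have : (fun t => \sum_j pi j *
      (freq R t (color_count t w) j - freq R t (color_count t w) h)) @ \oo -->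
      \sum_j pi j * 0.
    by apply: cvg_sum_ord => j; apply: cvgMr; exact: freq_diff_cvg0.
  by under eq_bigr do rewrite mulr0; rewrite big1_eq.
apply/andP; split.
  (* Whenever the potential is at most [b], its logarithm is too, so the mean frequency is at least
     [exp (- b)]. This happens at arbitrarily late times, so the limit cannot be smaller. *)
  suff : expR (- b) <= l by apply: lt_le_trans; exact: expR_gt0.
  rewrite leNgt; apply/negP => lb.
  have [n0 _ Hn0] : \forall t \near \oo, mean_freq pi t (color_count t w) < expR (- b).
    by apply: (cvgr_lt l).
  have [t nt Pt] := Pb (maxn n0 tau).
  have := Hn0 t (leq_trans (leq_maxl _ _) nt); apply/negP; rewrite -leNgt.
  have taut := leq_trans (leq_maxr _ _) nt.
  have [ffk kt ffe] := color_count_facts (old_mono taut oldw).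
  have t0 : 0 < t%:R :> R by exact: time_gt0R ffk kt ffe.
  have massE : mass pi (color_count t w) = t%:R * mean_freq pi t (color_count t w).
    rewrite /mass /mean_freq mulr_sumr; apply: eq_bigr => h _.
    by rewrite /freq; field; rewrite gt_eqF.
  have S0 : 0 < mass pi (color_count t w).
    have [j ffj] := ffe; rewrite /mass (bigD1 j)//= ltr_pwDl//.
      rewrite mulr_gt0// ltr0n; apply: leq_trans (ffk j); by rewrite ffj.
    by apply: sumr_ge0 => h _; rewrite mulr_ge0// ltW.
  have th0 := theta_sum_ge0 theta_gt0.
  have u0 : 0 < theta_sum theta + t%:R by lra.
  have : ln ((theta_sum theta + t%:R) / mass pi (color_count t w)) <= b.
    apply: le_trans Pt; rewrite lerDl divr_ge0// ltW//.
  rewrite -ler_expR lnK ?posrE ?divr_gt0// ler_pdivrMr// => uS.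
  rewrite expRN -(ler_pM2l t0) -massE ler_pdivrMr ?expR_gt0// mulrC.
  by apply: le_trans uS; rewrite lerDr.
rewrite -(cvg_lim _ Ml)//; apply: limr_le; first by apply/cvg_ex; exists l.
by exists tau => // t /= taut; exact: M1.
Qed.

End InteractingUrns.

(** * Assembly of the almost sure statement *)

Lemma exists_pos_lower_bound (R : realType) (I : finType) (a : I -> R) :
  (forall i, 0 < a i) -> exists2 delta, 0 < delta & forall i, delta <= a i.
Proof.
(* [s] exceeds every [(a i)^-1], so its inverse is below every [a i]; the summand 1 keeps [s]
   positive even over an empty type. *)
move=> a0; pose s := 1 + \sum_i (a i)^-1.
have s0 : 0 < s by rewrite ltr_pwDl// sumr_ge0// => i _; rewrite invr_ge0 ltW.
exists s^-1; first by rewrite invr_gt0.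
move=> i; rewrite -[leRHS]invrK lef_pV2 ?posrE ?invr_gt0// /s (bigD1 i)//= addrCA.
by rewrite lerDl addr_ge0// sumr_ge0// => j _; rewrite invr_ge0 ltW.
Qed.

Theorem theorem2 (R : realType) (d : measure_display) (T : measurableType d)
  (P : probability T R) (N : nat) (theta : 'I_N -> R) (Gamma Lambda W : 'M[R]_N)
  (C : nat -> 'I_N -> T -> nat) :
  (0 < N)%N ->
  (forall h, 0 < theta h) ->
  (forall j h, 0 <= Gamma j h) -> (forall j h, 0 <= Lambda j h) ->
  W = Gamma + Lambda ->
  (forall h, \sum_(j < N) W j h = 1) ->
  (forall h, \sum_(j < N) Gamma j h < 1) ->
  (forall h, 0 < Lambda h h) ->
  irreducible_mx W ->
  (* the draws are random variables *)
  (forall t h c, measurable [set w | C t h w = c]) ->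
  (* the same new color is never drawn simultaneously from two urns *)
  P.-negligible [set w | exists t h h', h != h' /\ C t h w = C t h' w /\
                          ~~ old (histw C w) t (C t h w)] ->
  (* dynamics: conditionally on F_t the draws at time t+1 are independent,
     new with probability Z*_{t,h}, equal to the old color c with
     probability P_t(h,c) *)
  (forall t (H : nat -> 'I_N -> nat) (y : 'I_N -> option nat),
     (forall h c, y h = Some c -> old H t c) ->
     P (hist_ev C t H `&` [set w | forall h, typ C t h w = y h]) =
     (P (hist_ev C t H) * (\prod_(h < N) kern theta Gamma W H t h (y h))%:E)%E) ->
  forall c : nat,
  exists Kinf : T -> R,
    measurable_fun setT Kinf /\
    {ae P, forall w, (exists t h, C t h w = c) ->
       [/\ 0 < Kinf w <= 1,
        forall h, (fun t : nat => (Kc (histw C w) t h c)%:R / t%:R : R)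
                    @ \oo --> Kinf w &
        forall h, (fun t : nat => (Kc (histw C w) t h c)%:R /
                    (\sum_(j < N) (Kc (histw C w) t j c)%:R) : R)
                    @ \oo --> ((N%:R)^-1 : R)]}.
Proof.
move=> N0 theta0 G0 L0 WE Wsum Gsum Lhh Wirr Cm _ dyn c.
have [pi [pi0 pi1] pist] := exists_stationary N0 (W_ge0 G0 L0 WE) Wsum Wirr.
have [delta delta0 dle] :=
  exists_pos_lower_bound (fun j => mulr_gt0 (pi0 j) (Lhh j)).
pose kappa := 2 * (1 + delta^-1).
have kappa0 : 0 <= kappa by rewrite mulr_ge0// addr_ge0// invr_ge0 ltW.
pose h0 := Ordinal N0.
pose x t w h := freq R t (color_count C c t w) h.
(* The upper limit is defined for every [w] and measurable, as the frequencies lie in [[0, 1]]; it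
   equals the common limit wherever that exists. *)
exists (fun w => limn_sup (fun t => x t w h0)); split.
  apply: (@measurable_fun_limn_sup _ _ _ setT (fun t w => x t w h0)).
  - move=> w _; exists 1 => _ [t _ <-]; rewrite /x /freq.
    (* At time 0 the frequency is 0, because the inverse of 0 is 0. *)
    have [->|t0] := posnP t; first by rewrite invr0 mulr0.
    by rewrite ler_pdivrMr ?ltr0n// mul1r ler_nat Kc_le.
  - by move=> w _; exists 0 => _ [t _ <-]; exact: freq_ge0.
  - move=> t; case: (adapted_boundedW Cm
      (adapted_bounded_count C c t (fun k => freq R t k h0))) => //.
(* The event that [c] is ever drawn is the countable union over [tau] of the events that [c] is old
   at [tau + 1], so countably many null sets suffice. *)
have main tau : {ae P, forall w, old (histw C w) tau.+1 c ->
    exists2 l : R, 0 < l <= 1 & forall h, (fun t => x t w h) @ \oo --> l}.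
  have D := ae_dirichlet_cvg0 theta0 G0 L0 WE Wsum Gsum pi0 pi1 pist Cm dyn c
    (ltn0Sn tau).
  have M := ae_mean_freq_cvg theta0 G0 L0 WE Wsum Gsum pi0 pi1 pist Cm dyn c
    (ltn0Sn tau).
  have Q := ae_potential_bounded theta0 G0 L0 WE Wsum Gsum pi0 pi1 pist Cm dyn c
    tau.+1 delta0 dle erefl.
  move: D M Q; apply: filterS3 => w D M Q oldw.
  exact: (freq_cvg theta0 G0 L0 WE pi0 pi1 Wirr oldw kappa0 (D oldw)
    (M oldw) (Q oldw)).
have := ae_foralln main; apply: filterS => w {}main [t [h Cth]].
have oldw : old (histw C w) t.+1 c by apply/oldP; exists t, h.
have [l l01 xl] := main t oldw.
have -> : limn_sup (fun t => x t w h0) = l.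
  by rewrite cvg_limn_supE; [exact: cvg_lim|apply/cvg_ex; exists l].
split=> // h'.
have /andP[l0 _] := l01.
have sl : (fun t => \sum_(j < N) x t w j) @ \oo --> l *+ N.
  have := cvg_sum_ord (fun j => xl j).
  by rewrite sumr_const card_ord.
have lN : l *+ N != 0 by rewrite mulrn_eq0 negb_or -lt0n N0 gt_eqF.
(* Positivity of [l] allows passing to the limit in the quotient of the frequencies. *)
have -> : N%:R^-1 = l / (l *+ N) :> R.
  by rewrite -[l *+ N]mulr_natr invfM mulrA divff ?mul1r// gt_eqF.
apply: (cvg_trans _ (cvgM (xl h') (cvgV lN sl))).
(* From time 1 on, the factor [1 / n] cancels between numerator and denominator. *)
apply: near_eq_cvg; exists 1%N => // n /= n0.
rewrite /x /freq /= -mulr_suml invfM invrK mulrACA mulVf ?mulr1//.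
by rewrite pnatr_eq0 -lt0n.
Qed.
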